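(* Let $\gamma : (\mathbb{R}, 0) \to \mathbb{R}P^{N+1}$ be a $C^\infty$ curve-germ of finite type at $0$. Then $\gamma$ is frontal. Moreover the tangent map $\mathrm{Tan}(\gamma) : (\mathbb{R}^2, 0) \to \mathbb{R}P^{N+1}$ of $\gamma$ is frontal.
   Context: All manifolds and maps are $C^\infty$. Frontal maps. Let $n\le m$. A map(-germ) $f : N^n \to M^m$ is called frontal if (i) its regular locus $\mathrm{Reg}(f)=\{x \in N : f \text{ is an immersion at } x\}$ is dense in $N$, and (ii) there is a $C^\infty$ map $\widetilde f : N \to \mathrm{Gr}(n, TM) = \bigcup_{y\in M}\mathrm{Gr}(n, T_yM)$ (the bundle of $n$-planes tangent to $M$) with $\widetilde f(x) = f_*(T_xN)$ for all $x \in \mathrm{Reg}(f)$. For germs these conditions are required for some representative. Finite type and type. Let $\gamma$ be a curve in $\mathbb{R}P^m$, and write $\gamma(t) = (x_1(t),\dots,x_m(t))$ near $t_0$ in projective (affine) local coordinates centred at $\gamma(t_0)$. Let $W_k(t) = (\gamma'(t), \gamma''(t),\dots,\gamma^{(k)}(t))$, an $m\times k$ matrix, $1\le k\le\infty$. The curve $\gamma$ is of finite type at $t_0$ if $W_\infty(t_0)$ has rank $m$. In that case put $a_i = \min\{k : \mathrm{rank}\, W_k(t_0) = i\}$, $1\le i\le m$; then $1\le a_1<\dots<a_m$ and $\gamma$ is said to be of type $(a_1,\dots,a_m)$ at $t_0$. Tangent map. For $\gamma$ of type $(a_1,\dots,a_{N+1})$ at $0$, written as $\gamma(t) = (x_1(t),\dots,x_{N+1}(t))$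 near $t=0$ in projective (affine) local coordinates of $\mathbb{R}P^{N+1}$ centred at $\gamma(0)$, the tangent map is the map-germ $\mathrm{Tan}(\gamma)(s,t) = \gamma(t) + s\,\dfrac{1}{t^{a_1-1}}\gamma'(t)$ at $(s,t)=(0,0)$ (here $\gamma'(t)/t^{a_1-1}$ extends smoothly and without zeros to $t=0$). *)

(* Defs.v *)
From mathcomp Require Import all_boot all_order all_algebra.
From mathcomp Require Import all_classical all_reals all_analysis.

Set Implicit Arguments.
Unset Strict Implicit.
Unset Printing Implicit Defensive.

Import Order.TTheory GRing.Theory Num.Theory.
Import numFieldNormedType.Exports.

Local Open Scope classical_set_scope.
Local Open Scope ring_scope.

(* C^oo on the open set U: every iterated directional derivative of f is
   (Frechet) differentiable at every point of U.  As U is open, the values of f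
   outside U are irrelevant. *)
Definition smooth_on (R : realType) (V W : normedModType R) (U : set V)
    (f : V -> W) : Prop :=
  forall s : seq V, {in U, forall x,
    differentiable (foldr (fun v g y => 'D_v g y) f s) x}.

(* Real projective space, its points being the lines of R^(m+1). *)
Record RP (R : realType) (m : nat) := MkRP {
  line : {vspace 'rV[R]_(1 + m)};
  _ : \dim line = 1%N }.

(* A projective frame; it indexes an affine chart of RP^m. *)
Record frame (R : realType) (m : nat) := MkFrame {
  frame_mx : 'M[R]_(1 + m);
  _ : frame_mx \in unitmx }.

(* Homogeneous coordinates of p in the frame g, defined up to a common factor. *)
Definition homog (R : realType) m (g : frame R m) (p : RP R m) : 'rV[R]_(1 + m) :=
  vpick (line p) *m frame_mx g.

Definition chart_dom (R : realType) m (g : frame R m) : set (RP R m) :=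
  [set p | lsubmx (homog g p) 0 0 != 0].

(* [X_0 : X_1 : ... : X_m] |-> (X_1 / X_0, ..., X_m / X_0). *)
Definition chart (R : realType) m (g : frame R m) (p : RP R m) : 'rV[R]_m :=
  (lsubmx (homog g p) 0 0)^-1 *: rsubmx (homog g p).

Definition centred (R : realType) m (g : frame R m) (p : RP R m) : Prop :=
  chart_dom g p /\ chart g p = 0.

Lemma affine_vec_neq0 (R : realType) m (g : frame R m) (x : 'rV[R]_m) :
  row_mx 1%:M x *m invmx (frame_mx g) != 0.
Proof.
case: g => g gU /=; apply/eqP => /(congr1 (mulmx^~ g)).
rewrite mulmxKV // mul0mx -(row_mx0 R 1 1 m) => /eq_row_mx [/matrixP/(_ 0 0)].
by rewrite !mxE eqxx => /eqP; rewrite oner_eq0.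
Qed.

Lemma affine_line_dim (R : realType) m (g : frame R m) (x : 'rV[R]_m) :
  \dim <[row_mx 1%:M x *m invmx (frame_mx g)]>%VS = 1%N.
Proof. by rewrite dim_vline affine_vec_neq0. Qed.

(* The inverse of [chart g]. *)
Definition affine_pt (R : realType) m (g : frame R m) (x : 'rV[R]_m) : RP R m :=
  MkRP (affine_line_dim g x).

Definition smooth_RP (R : realType) n m (U : set 'rV[R]_n)
    (f : 'rV[R]_n -> RP R m) : Prop :=
  {in U, forall x, exists (g : frame R m) (V : set 'rV[R]_n),
    [/\ open V, V x, V `<=` f @^-1` chart_dom g & smooth_on V (chart g \o f)]}.

(* A point of the bundle Gr(n, T RP^m).  The tangent plane at [base] is recorded
   by its expression in one affine chart, as the row space of the matrix [dirs].
   Different records may represent the same plane. *)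
Record tplane (R : realType) (n m : nat) := MkTplane {
  base : RP R m;
  tframe : frame R m;
  dirs : 'M[R]_m;
  _ : chart_dom tframe base;
  _ : \rank dirs = n }.

(* The expression of the plane P in the chart h, obtained by applying the
   derivative of the transition map. *)
Definition plane_in (R : realType) n m (h : frame R m) (P : tplane R n m)
    : 'M[R]_m :=
  dirs P *m 'J (chart h \o affine_pt (tframe P)) (chart (tframe P) (base P)).

(* Smoothness on V of y |-> row space of W y as a map into Gr(k, R^m), its values
   lying in the standard chart of the k-planes that are graphs over the
   coordinates in the image of s: such a plane is the row space of a unique
   k x m matrix whose columns indexed by s form the identity. *)
Definition smooth_in_Gr_chart (R : realType) n k m (s : 'I_k -> 'I_m)
    (V : set 'rV[R]_n) (W : 'rV[R]_n -> 'M[R]_m) : Prop :=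
  exists A : 'rV[R]_n -> 'M[R]_(k, m),
    smooth_on V A /\
    {in V, forall y, colsub s (A y) = 1%:M /\ (A y == W y)%MS}.

Definition smooth_tplane (R : realType) n k m (U : set 'rV[R]_n)
    (F : 'rV[R]_n -> tplane R k m) : Prop :=
  {in U, forall x, exists (h : frame R m) (s : 'I_k -> 'I_m) (V : set 'rV[R]_n),
    [/\ open V, V x, V `<=` [set y | chart_dom h (base (F y))],
        smooth_on V (fun y => chart h (base (F y))) &
        smooth_in_Gr_chart s V (fun y => plane_in h (F y))]}.

Definition Reg (R : realType) n m (f : 'rV[R]_n -> RP R m) : set 'rV[R]_n :=
  [set x | exists g : frame R m,
    chart_dom g (f x) /\ \rank ('J (chart g \o f) x) = n].

(* P = f_*(T_x R^n). *)
Definition is_pushforward (R : realType) n m (f : 'rV[R]_n -> RP R m)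
    (x : 'rV[R]_n) (P : tplane R n m) : Prop :=
  base P = f x /\ (dirs P == 'J (chart (tframe P) \o f) x)%MS.

(* n <= m is automatic when U is nonempty, since then Reg f is nonempty. *)
Definition frontal_on (R : realType) n m (U : set 'rV[R]_n)
    (f : 'rV[R]_n -> RP R m) : Prop :=
  [/\ smooth_RP U f,
      U `<=` closure (U `&` Reg f) &
      exists F : 'rV[R]_n -> tplane R n m,
        smooth_tplane U F /\ {in U `&` Reg f, forall x, is_pushforward f x (F x)}].

Definition smooth_germ (R : realType) n m (f : 'rV[R]_n -> RP R m) : Prop :=
  exists U : set 'rV[R]_n, [/\ open U, U 0 & smooth_RP U f].

Definition frontal_germ (R : realType) n m (f : 'rV[R]_n -> RP R m) : Prop :=
  exists U : set 'rV[R]_n, [/\ open U, U 0 & frontal_on U f].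

(* A curve as a map on R^1 = 'rV_1. *)
Definition curve_map (R : realType) m (gamma : R -> RP R m) (x : 'rV[R]_1)
    : RP R m :=
  gamma (x 0 0).

Definition Wmx (R : realType) m (c : R -> 'rV[R]_m) (k : nat) (t : R)
    : 'M[R]_(m, k) :=
  \matrix_(i < m, j < k) (derive1n j.+1 c t) 0 i.

(* W_oo(t) has rank m iff some finite block W_k(t) does: the rank of a matrix
   with infinitely many columns is the largest rank of its finite blocks. *)
Definition finite_type (R : realType) m (gamma : R -> RP R m) (t : R) : Prop :=
  exists g : frame R m,
    centred g (gamma t) /\ exists k, \rank (Wmx (chart g \o gamma) k t) = m.

(* a_i = min {k | rank W_k(t) = i}, and 0 if there is no such k. *)
Definition type_entry (R : realType) m (c : R -> 'rV[R]_m) (t : R) (i : nat)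
    : nat :=
  xget 0%N [set k | \rank (Wmx c k t) = i /\
                    forall j, \rank (Wmx c j t) = i -> (k <= j)%N].

(* c'(t) / t^(a_1 - 1), extended by its limit at t = 0. *)
Definition tangent_dir (R : realType) m (c : R -> 'rV[R]_m) (t : R) : 'rV[R]_m :=
  let a1 := type_entry c 0 1 in
  let q := fun t : R => (t ^+ a1.-1)^-1 *: derive1 c t in
  if t == 0 then lim (q r @[r --> 0^']) else q t.

(* The tangent map of gamma in the affine coordinates of g; the point (s, t) of
   R^2 is the row vector with entries s and t. *)
Definition Tan (R : realType) m (g : frame R m) (gamma : R -> RP R m)
    (x : 'rV[R]_2) : RP R m :=
  let c := chart g \o gamma in
  let s := x 0 0 in
  let t := x 0 1 in
  affine_pt g (c t + s *: tangent_dir c t).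

(* Main.v *)
(* Hadamard's lemma lets one divide by powers of t.  In an affine chart centred at
   gamma(0), the velocity is c' = t^b e with e smooth and e(0) <> 0, since finite
   type forbids a flat c; the line spanned by e extends the tangent line.
   For the tangent map c(t) + s e(t), the tangent plane is spanned by e and s e'.
   Normalise e by a coordinate e_i not vanishing at 0: modulo e, the vector e' is
   t^b' w / e_i with w(0) <> 0 and w_i = 0.  Indeed, if all the Wronskians
   e_i e_j' - e_j e_i' were flat, then so would be some nonzero linear combination
   c_j - r c_i, against finite type.  The plane spanned by e and w is smooth and
   depends on t only, and it is the tangent plane wherever s t <> 0.
   Flatness of linear combinations of the coordinates does not depend on the centred
   chart, because two charts differ by a linear map and a nonvanishing factor
   applied to a homogeneous lift of gamma. *)

From HB Require Import structures.
Require Import Defs.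
From mathcomp Require Import all_boot all_order all_algebra.
From mathcomp Require Import all_classical all_reals all_analysis.
From mathcomp Require Import ring.

Set Implicit Arguments.
Unset Strict Implicit.
Unset Printing Implicit Defensive.

Import Order.TTheory GRing.Theory Num.Theory.
Import numFieldNormedType.Exports.

Local Open Scope classical_set_scope.
Local Open Scope ring_scope.

(** * Calculus of smooth maps *)

Local Notation iterD s f := (foldr (fun v g y => 'D_v g y) f s).

Section SmoothOn.
Context {R : realType} {V W : normedModType R}.
Implicit Types (U : set V) (f g : V -> W).

Lemma smooth_onP U f :
  smooth_on U f <-> forall s x, U x -> differentiable (iterD s f) x.
Proof.
split=> H s x; first by move=> Ux; apply: H; rewrite inE.
by rewrite inE; exact: H.
Qed.

Lemma smooth_on_differentiable U f x : smooth_on U f -> U x -> differentiable f x.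
Proof. by move=> /smooth_onP /(_ [::] x). Qed.

Lemma smooth_on_derivable U f x v : smooth_on U f -> U x -> derivable f x v.
Proof. by move=> fs Ux; apply/diff_derivable/(smooth_on_differentiable fs). Qed.

Lemma smooth_on_continuous U f x :
  smooth_on U f -> U x -> {for x, continuous f}.
Proof. by move=> fs Ux; apply/differentiable_continuous/(smooth_on_differentiable fs). Qed.

Lemma smooth_on_derive U f v : smooth_on U f -> smooth_on U ('D_v f).
Proof.
move=> /smooth_onP fs; apply/smooth_onP => s x Ux.
by have := fs (rcons s v) x Ux; rewrite foldr_rcons.
Qed.

Lemma smooth_on_sub U U' f : U' `<=` U -> smooth_on U f -> smooth_on U' f.
Proof. by move=> UU /smooth_onP fs; apply/smooth_onP => s x /UU; exact: fs. Qed.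

Lemma near_eq_on U f g x : open U -> U x -> (forall y, U y -> f y = g y) ->
  \forall y \near x, f y = g y.
Proof. by move=> oU Ux fg; apply: filterS (open_nbhs_nbhs (conj oU Ux)). Qed.

Lemma eq_on_derive U f g v : open U -> (forall y, U y -> f y = g y) ->
  forall y, U y -> 'D_v f y = 'D_v g y.
Proof.
by move=> oU fg y Uy; apply: near_eq_derive; exact: near_eq_on oU Uy fg.
Qed.

Lemma eq_on_iterD U f g s : open U -> (forall y, U y -> f y = g y) ->
  forall y, U y -> iterD s f y = iterD s g y.
Proof. by move=> oU fg; elim: s => //= v s IH; exact: eq_on_derive. Qed.

(** A first-order expansion of [f] at [x] is also one of [g], and uniqueness of the differential
    makes ['d f x] the differential of [g]. *)
Lemma near_eq_differentiable f g x : (\forall y \near x, f y = g y) ->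
  differentiable f x -> differentiable g x.
Proof.
move=> fg /diff_locallyP [dc fE].
have gE : g \o shift x = cst (g x) + 'd f x +o_ 0 id.
  have fg0 : \forall y \near 0, f (y + x) = g (y + x).
    by move: fg; rewrite {1}(near_shift 0 x) subr0.
  apply/eqaddoP => e e0; move/eqaddoP/(_ e e0): fE; apply: filterS2 fg0 => y.
  rewrite /= -(nbhs_singleton fg) => yE; congr (_ <= _).
  exact: (congr1 (fun z => `|z - (f x + 'd f x y)|) yE).
by apply/diff_locallyP; rewrite (diff_unique dc gE).
Qed.

Lemma eq_smooth_on U f g : open U -> (forall y, U y -> f y = g y) ->
  smooth_on U f -> smooth_on U g.
Proof.
move=> oU fg /smooth_onP fs; apply/smooth_onP => s x Ux.
apply: near_eq_differentiable (fs s x Ux).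
exact: near_eq_on oU Ux (eq_on_iterD s oU fg).
Qed.

End SmoothOn.

Section SmoothPrecomp.
Context {R : realType} {V V' W : normedModType R}.

Lemma derive_precomp (L : {linear V' -> V}) (f : V -> W) v x :
  'D_v (f \o L) x = 'D_(L v) f (L x).
Proof. by rewrite /derive; under eq_fun do rewrite /= linearP. Qed.

(** Deriving [f \o L] along [v] is deriving [f] along [L v], so iterated derivatives along [s]
    become those along [map L s]. *)
Lemma smooth_on_precomp (U : set V) (L : {linear V' -> V}) (f : V -> W) :
  continuous L -> smooth_on U f -> smooth_on (L @^-1` U) (f \o L).
Proof.
move=> cL /smooth_onP fs; apply/smooth_onP => s x /= Ux.
have -> : iterD s (f \o L) = iterD (map L s) f \o L.
  elim: s => //= v s ->; apply/funext => y; exact: derive_precomp.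
apply: differentiable_comp; last exact: fs.
exact: linear_differentiable.
Qed.

End SmoothPrecomp.

(** * Algebra of smooth scalar functions *)

Section SmoothScalar.
Context {R : realType} {V : normedModType R}.
Variable U : set V.
Hypothesis oU : open U.

(* If derivatives of generators lie in the generated algebra, then so do all
   iterated derivatives of its elements; hence [salg_smooth_on], which gives the
   stability of smoothness under products and inverses without any Leibniz formula
   of higher order. *)
Inductive salg (S : set (V -> R^o)) : (V -> R^o) -> Prop :=
| salg_base f : S f -> salg S f
| salg_cst a : salg S (cst a)
| salg_add f g : salg S f -> salg S g -> salg S (f + g)
| salg_mul f g : salg S f -> salg S g -> salg S (f * g)
| salg_ext f g : (forall x, U x -> f x = g x) -> salg S f -> salg S g.

Lemma salg_smooth_on (S : set (V -> R^o)) :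
  (forall f, S f -> forall x, U x -> differentiable f x) ->
  (forall f v, S f -> salg S ('D_v f)) ->
  forall f, salg S f -> smooth_on U f.
Proof.
move=> Sd SD.
(* Sum and product rules give identities of functions on [U] only; the constructor [salg_ext]
   absorbs this. *)
have step f : salg S f ->
    (forall x, U x -> differentiable f x) /\ forall v, salg S ('D_v f).
  elim=> {f} [f Sf|a|f g sf [df Df] sg [dg Dg]|f g sf [df Df] sg [dg Dg]
             |f g fg sf [df Df]].
  - by split; [exact: Sd|move=> v; exact: SD].
  - split=> [x _|v]; first exact: differentiable_cst.
    apply: salg_ext (salg_cst S 0) => x _.
    by rewrite derive_cst.
  - split=> [x Ux|v]; first by apply: differentiableD; [exact: df|exact: dg].
    apply: salg_ext (salg_add (Df v) (Dg v)) => x Ux.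
    by rewrite deriveD //; apply/diff_derivable; [exact: df|exact: dg].
  - split=> [x Ux|v]; first by apply: differentiableM; [exact: df|exact: dg].
    apply: salg_ext (salg_add (salg_mul sf (Dg v)) (salg_mul sg (Df v))) => x Ux.
    by rewrite deriveM //; apply/diff_derivable; [exact: df|exact: dg].
  - split=> [x Ux|v].
      by apply: near_eq_differentiable (df x Ux); exact: near_eq_on oU Ux fg.
    by apply: salg_ext (Df v) => x Ux; exact: eq_on_derive fg _ Ux.
move=> f sf; apply/smooth_onP => s x Ux.
suff /step[] : salg S (iterD s f) by move/(_ x Ux).
by elim: s => //= v s /step[_ /(_ v)].
Qed.

(** All smooth functions are taken as generators; their derivatives are generators again. *)
Lemma salg_smooth (f : V -> R^o) : salg (smooth_on U) f -> smooth_on U f.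
Proof.
apply: salg_smooth_on => [g gs x|g v gs]; first exact: smooth_on_differentiable.
by apply: salg_base; exact: smooth_on_derive.
Qed.

Lemma smooth_on_cst (a : R^o) : smooth_on U (cst a).
Proof. exact/salg_smooth/salg_cst. Qed.

Lemma smooth_onD (f g : V -> R^o) :
  smooth_on U f -> smooth_on U g -> smooth_on U (f + g).
Proof. by move=> fs gs; apply/salg_smooth/salg_add; exact: salg_base. Qed.

Lemma smooth_onM (f g : V -> R^o) :
  smooth_on U f -> smooth_on U g -> smooth_on U (f * g).
Proof. by move=> fs gs; apply/salg_smooth/salg_mul; exact: salg_base. Qed.

Lemma smooth_onN (f : V -> R^o) : smooth_on U f -> smooth_on U (- f).
Proof.
move=> fs; apply: (eq_smooth_on oU _ (smooth_onM (smooth_on_cst (-1)) fs)).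
by move=> x _; rewrite /= mulN1r.
Qed.

Lemma smooth_onB (f g : V -> R^o) :
  smooth_on U f -> smooth_on U g -> smooth_on U (f - g).
Proof. by move=> fs gs; apply: smooth_onD => //; exact: smooth_onN. Qed.

Lemma smooth_on_sum I (r : seq I) (f : I -> V -> R^o) :
  (forall i, smooth_on U (f i)) -> smooth_on U (\sum_(i <- r) f i).
Proof.
move=> fs; elim: r => [|i r IH]; first by rewrite big_nil; exact: smooth_on_cst.
by rewrite big_cons; exact: smooth_onD.
Qed.

(** The generators are the smooth functions together with [1/f], whose derivative [- f' (1/f) (1/f)]
    is a product of generators. *)
Lemma smooth_onV (f : V -> R^o) : smooth_on U f -> (forall x, U x -> f x != 0) ->
  smooth_on U (fun x => (f x)^-1).
Proof.
move=> fs f0; pose S : set (V -> R^o) :=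
  fun g => smooth_on U g \/ g = (fun x => (f x)^-1).
apply: (@salg_smooth_on S); last by apply: salg_base; right.
- move=> g [gs|->] x Ux; first exact: smooth_on_differentiable gs Ux.
  by apply: differentiableV (f0 x Ux); exact: smooth_on_differentiable fs Ux.
- move=> g v [gs|->]; first by apply/salg_base; left; exact: smooth_on_derive.
  have sV : salg S (fun x => (f x)^-1) by apply: salg_base; right.
  have sD : salg S (- 'D_v f).
    by apply/salg_base; left; apply/smooth_onN/smooth_on_derive.
  apply: salg_ext (salg_mul sD (salg_mul sV sV)) => x Ux.
  rewrite deriveV ?f0 //; last exact: smooth_on_derivable fs Ux.
  by rewrite /= /GRing.scale /= expr2 invfM mulrC mulNr mulrN.
Qed.

End SmoothScalar.

(** * Smoothness of matrix-valued maps, entry by entry *)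

Section SmoothMatrix.
Context {R : realType} {V : normedModType R} {m n : nat}.
Implicit Types (U : set V) (M : V -> 'M[R]_(m, n)).

Lemma differentiable_mxP M x :
  differentiable M x <-> forall i j, differentiable (fun y => M y i j : R^o) x.
Proof.
split=> [dM i j|dM].
  by apply: (@differentiable_comp _ _ _ _ M (fun N => N i j : R^o)) => //;
     exact: differentiable_coord.
(* Entries times constant elementary matrices reduce the claim to scalar functions. *)
have -> : M = \sum_(i < m) \sum_(j < n) (fun y => M y i j *: delta_mx i j).
  apply/funext => y; rewrite {1}[M y]matrix_sum_delta fct_sumE.
  by apply: eq_bigr => i _; rewrite fct_sumE.
apply: differentiable_sum => i; apply: differentiable_sum => j.
exact: (@differentiableZl _ _ _ (fun y => M y i j)).
Qed.

Lemma smooth_on_mxP U M : open U ->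
  smooth_on U M <-> forall i j, smooth_on U (fun y => M y i j : R^o).
Proof.
move=> oU; split=> Ms.
- move=> i j; apply/smooth_onP => s x Ux.
  have H : forall y, U y -> iterD s M y i j = iterD s (fun y => M y i j : R^o) y.
    elim: s => //= v s IH y Uy; rewrite -(eq_on_derive v oU IH Uy).
    rewrite derive_mx ?mxE //; apply/diff_derivable.
    by move/smooth_onP: Ms; exact.
  apply: near_eq_differentiable (near_eq_on oU Ux H) _.
  by move/smooth_onP: Ms => /(_ s x Ux)/differentiable_mxP/(_ i j).
- apply/smooth_onP => s.
  have H : forall y, U y ->
      iterD s M y = \matrix_(i, j) iterD s (fun y => M y i j : R^o) y.
    elim: s => [|v s IH] y Uy /=; first by apply/matrixP => i j; rewrite mxE.
    rewrite (eq_on_derive v oU IH Uy) derive_mx.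
      by apply/matrixP => i j; rewrite !mxE; under eq_fun do rewrite mxE.
    apply/derivable_mxP => i j; under eq_fun do rewrite mxE.
    apply/diff_derivable.
    by move/smooth_onP: (Ms i j); exact.
  move=> x Ux; apply: near_eq_differentiable.
    by apply: (near_eq_on oU Ux) => y Uy; rewrite H.
  apply/differentiable_mxP => i j; under eq_fun do rewrite mxE.
  by move/smooth_onP: (Ms i j); exact.
Qed.

End SmoothMatrix.

(** * Hadamard's lemma and flat functions *)

Section OneVariable.
Context {R : realType}.
Implicit Types (U : set R^o) (f g h : R^o -> R^o).

Lemma smooth_on_derive1n {W : normedModType R} (U : set R^o) (f : R^o -> W) k :
  smooth_on U f -> smooth_on U (derive1n k f : R^o -> W).
Proof.
move=> fs; elim: k => // k IH; rewrite derive1nS.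
have -> : (derive1 (derive1n k f) : R^o -> W) = 'D_1 (derive1n k f : R^o -> W).
  by apply/funext => t; rewrite derive1E.
exact: smooth_on_derive.
Qed.

Lemma smooth_on_is_derive U f k (t : R^o) : smooth_on U f -> U t ->
  is_derive t (1 : R^o) (derive1n k f : R^o -> R^o) (derive1n k.+1 f t).
Proof.
move=> fs Ut; apply: DeriveDef.
  by apply: smooth_on_derivable Ut; exact: smooth_on_derive1n.
by rewrite derive1nS derive1E.
Qed.

Lemma eq_on_derive1n {W : normedModType R} (U : set R^o) (f g : R^o -> W) k :
  open U -> (forall t, U t -> f t = g t) -> forall t, U t -> derive1n k f t = derive1n k g t.
Proof.
move=> oU fg; elim: k => // k IH t Ut; rewrite !derive1nS !derive1E.
exact: (eq_on_derive (1 : R^o) oU IH).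
Qed.

Lemma derive1nD_on U f g k (t : R^o) : open U -> smooth_on U f -> smooth_on U g ->
  U t -> derive1n k (f + g) t = derive1n k f t + derive1n k g t.
Proof.
move=> oU fs gs; elim: k t => // k IH t Ut; rewrite !derive1nS !derive1E.
rewrite (eq_on_derive (1 : R^o) oU (g := (derive1n k f : R^o -> R^o) + derive1n k g)) //.
by rewrite deriveD //; apply: smooth_on_derivable Ut; exact: smooth_on_derive1n.
Qed.

(** Proves a function smooth by exhibiting all its derivatives at once. The [F k] generate an
    algebra stable under derivation, since the derivative of [F k] along the scalar [v] is [v] times
    [F k.+1]. *)
Lemma jets_smooth_on U (F : nat -> R^o -> R^o) : open U ->
  (forall k t, U t -> is_derive t (1 : R^o) (F k) (F k.+1 t)) ->
  smooth_on U (F 0%N) /\ forall k t, U t -> derive1n k (F 0%N) t = F k t.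
Proof.
move=> oU dF; have difF k t : U t -> differentiable (F k) t.
  by move=> Ut; apply/derivable1_diffP; have [] := dF k t Ut.
split; last first.
  elim=> // k IH t Ut; rewrite derive1nS derive1E (eq_on_derive (1 : R^o) oU IH) //.
  by have [_ ->] := dF k t Ut.
pose S : set (R^o -> R^o) := fun f => exists k, f = F k.
apply: (@salg_smooth_on _ _ _ oU S); last by apply: salg_base; exists 0%N.
- by move=> f [k ->] t; exact: difF.
- move=> f v [k ->].
  have sF : salg U S (F k.+1) by apply: salg_base; exists k.+1.
  apply: salg_ext (salg_mul (salg_cst U S v) sF) => t Ut.
  rewrite deriveE; last exact: difF.
  rewrite diff1E; last exact: difF.
  by rewrite derive1E; have [_ ->] := dF k t Ut.
Qed.

Lemma smooth_id U : open U -> smooth_on U (id : R^o -> R^o).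
Proof.
move=> oU; pose F k : R^o -> R^o :=
  if k is k'.+1 then (if k' is _.+1 then cst 0 else cst 1) else id.
have [] // := @jets_smooth_on U F oU.
move=> [|[|k]] t _ /=; [exact: is_derive_id| |]; exact: is_derive_cst.
Qed.

Lemma smooth_expr U n : open U -> smooth_on U (fun t : R^o => t ^+ n : R^o).
Proof.
move=> oU; elim: n => [|n IH].
  by apply: (eq_smooth_on oU _ (smooth_on_cst oU 1)) => t _; rewrite expr0.
by apply: (eq_smooth_on oU _ (smooth_onM oU (smooth_id oU) IH)) => t _; rewrite exprS.
Qed.

(** * Division of a smooth function by [t] *)

Section Hadamard.
Variables (U : set R^o) (f : R^o -> R^o).
Hypotheses (oU : open U) (U0 : U 0) (fs : smooth_on U f) (f0 : f 0 = 0).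

(* [hadamard_num k / t^(k+1)] is the [k]-th derivative of [f t / t] off [0], and
   (hadamard_num k)' = t^k f^(k+1), which makes l'Hopital's rule apply at [0]. *)
Fixpoint hadamard_num k : R^o -> R^o :=
  if k is k'.+1 then
    fun t => t ^+ k * derive1n k f t - k%:R * hadamard_num k' t
  else f.

(** The value at 0 is the one that the Taylor expansion of [f] predicts for the [k]-th derivative of
    [f t / t]. *)
Definition hadamard_quot k : R^o -> R^o := fun t =>
  if t == 0 then derive1n k.+1 f 0 / k.+1%:R else hadamard_num k t / t ^+ k.+1.

Lemma hadamard_num0 k : hadamard_num k 0 = 0.
Proof.
by elim: k => //= k ->; rewrite expr0n mul0r mulr0 subrr.
Qed.

(** The product rule on [t^(k+1) f^(k+1)] yields an extra term [(k+1) t^k f^(k+1)], which the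
    derivative of the previous numerator cancels. *)
Lemma hadamard_num_derive k (t : R^o) : U t ->
  is_derive t (1 : R^o) (hadamard_num k) (t ^+ k * derive1n k.+1 f t).
Proof.
move=> Ut; elim: k => [|k IH].
  by rewrite expr0 mul1r; exact: (smooth_on_is_derive 0).
have dk := smooth_on_is_derive k.+1 fs Ut.
have dX : is_derive t (1 : R^o) (fun t : R^o => t ^+ k.+1 : R^o) (k.+1%:R * t ^+ k).
  apply: DeriveDef; first exact: exprn_derivable.
  by rewrite exp_derive /= [LHS]mulr1.
have dM := is_deriveM dX dk; have dN := is_deriveZ k.+1%:R IH.
apply: is_derive_eq (is_deriveB dM dN) _.
by rewrite /GRing.scale /=; ring.
Qed.

Lemma hadamard_quot_derive_neq0 k (t : R^o) : U t -> t != 0 ->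
  is_derive t (1 : R^o) (hadamard_quot k) (hadamard_quot k.+1 t).
Proof.
move=> Ut t0; rewrite {2}/hadamard_quot (negPf t0).
have nt : \forall y \near t, hadamard_num k y * (y ^+ k.+1)^-1 = hadamard_quot k y.
  have : \forall y \near t, y != 0 by apply: open_nbhs_nbhs; split => //; exact: open_neq.
  by apply: filterS => y y0; rewrite /hadamard_quot (negPf y0).
apply: near_eq_is_derive nt _.
have tk0 : t ^+ k.+1 != 0 by rewrite expf_neq0.
have dX : is_derive t (1 : R^o) (fun t : R^o => (t ^+ k.+1)^-1 : R^o)
    (- (t ^+ k.+1) ^- 2 * (k.+1%:R * t ^+ k)).
  apply: DeriveDef; first by apply: derivableV => //; exact: exprn_derivable.
  rewrite deriveV //; last exact: exprn_derivable.
  by rewrite exp_derive /= [_ *: 1]mulr1.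
apply: is_derive_eq (is_deriveM (hadamard_num_derive k Ut) dX) _.
rewrite /GRing.scale /= !exprS; field.
by rewrite t0 expf_neq0.
Qed.

(** One use of l'Hopital's rule turns the difference quotient at 0 into
    [t^k (F1 t - F1 0) / ((k+2) t^(k+1))], that is, the difference quotient of [F1] divided by
    [k+2]. *)
Lemma hadamard_quot_derive0 k :
  is_derive (0 : R^o) (1 : R^o) (hadamard_quot k) (hadamard_quot k.+1 0).
Proof.
rewrite {2}/hadamard_quot eqxx.
set F1 := derive1n k.+1 f; set l := _ / _.
suff cl : (h^-1 *: (hadamard_quot k (h *: 1 + 0) - hadamard_quot k 0)) @[h --> (0:R^o)^'] --> (l : R^o).
  by apply: DeriveDef; [apply/cvg_ex; exists l|apply: cvg_lim].
have [e /= e0 eU] : nbhs (0 : R^o) U by exact: open_nbhs_nbhs (conj oU U0).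
(* The difference quotient of [hadamard_quot k] at 0, over the common denominator [t^(k+2)]. *)
pose q (t : R) := (hadamard_num k t - t ^+ k.+1 * (F1 0 / k.+1%:R)) / t ^+ k.+2.
suff cq : q t @[t --> 0^'] --> l.
  apply: cvg_trans cq; apply: near_eq_cvg.
  near=> t; have t0 : t != 0 by near: t; exact: nbhs_dnbhs_neq.
  rewrite /q [t *: 1]mulr1 addr0 /hadamard_quot eqxx (negPf t0) -/F1.
  rewrite /GRing.scale /= !exprS; field.
  by rewrite t0 expf_neq0 // addrC natr1 pnatr_eq0.
pose num (t : R) := hadamard_num k t - t ^+ k.+1 * (F1 0 / k.+1%:R).
(* At 0 the values [l] and 1 are assigned to [dnum] and [dden], so that the required limit amounts
   to continuity of their quotient at 0. *)
pose dnum (t : R) := if t == 0 then l else t ^+ k * (F1 t - F1 0).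
pose den (t : R) := t ^+ k.+2.
pose dden (t : R) := if t == 0 then 1 else k.+2%:R * t ^+ k.+1.
have itvU t : t \in `]-e, e[ -> U t.
  by rewrite in_itv /= -ltr_norml => te; apply: eU; rewrite /= sub0r normrN.
have dX n (t : R) : is_derive t (1 : R) (fun t : R => t ^+ n.+1) (n.+1%:R * t ^+ n).
  apply: DeriveDef; first exact: exprn_derivable.
  by rewrite exp_derive /= [LHS]mulr1.
have numD (t : R) : U t -> is_derive t (1 : R) num (t ^+ k * (F1 t - F1 0)).
  move=> Ut; have dM := is_deriveM (dX k t) (is_derive_cst (F1 0 / k.+1%:R : R) t (1:R)).
  apply: is_derive_eq (is_deriveB (hadamard_num_derive k Ut) dM) _.
  rewrite /GRing.scale /= /F1 !derive1nS; field.
  by rewrite addrC natr1 pnatr_eq0.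
apply: (@lhopital R num dnum den dden (- e) e 0 l).
- by rewrite in_itv /= oppr_lt0 e0.
- move=> t; rewrite inE => -[/itvU Ut /eqP/negPf t0].
  by rewrite /dnum t0; exact: numD.
- move=> t; rewrite inE => -[/itvU Ut /eqP/negPf t0].
  by rewrite /dden t0; exact: dX.
- have n0 : num 0 = 0 by rewrite /num hadamard_num0 expr0n mul0r subrr.
  rewrite -[X in _ --> X]n0.
  apply: (@differentiable_continuous R R^o R^o 0 num).
  by apply/derivable1_diffP; have [] := numD 0 U0.
- have d0 : den 0 = 0 by rewrite /den expr0n.
  rewrite -[X in _ --> X]d0.
  apply: (@differentiable_continuous R R^o R^o 0 den).
  by apply/derivable1_diffP; have [] := dX k.+1 (0 : R).
- move=> t; rewrite inE => -[_ /eqP/negPf t0].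
  by rewrite /dden t0 mulf_neq0 ?pnatr_eq0 // expf_neq0 // t0.
have ->: l = dnum 0 / dden 0 by rewrite /dnum /dden eqxx divr1.
apply/(@continuous_withinNx R^o R^o (fun t => dnum t / dden t) 0).
rewrite /dnum /dden eqxx divr1.
have [dF1 F1E] := smooth_on_is_derive k.+1 fs U0.
have lE : l = derive1n k.+2 f 0 * k.+2%:R^-1 by [].
have : (h^-1 *: (F1 (h *: 1 + 0) - F1 0)) @[h --> (0:R^o)^'] --> (derive1n k.+2 f 0 : R^o).
  by rewrite -F1E; exact: dF1.
move=> dc; have := cvgMr_tmp dc (b := (k.+2%:R^-1 : R)); rewrite -lE => {}dc.
apply: cvg_trans (dc _); apply: near_eq_cvg; near=> t.
have t0 : t != 0 by near: t; exact: nbhs_dnbhs_neq.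
have aux (a b c : R) : a != 0 -> c != 0 -> t^-1 * b / c = a * b / (c * (t * a)).
  by move=> a0 c0; field; rewrite a0 c0 t0.
rewrite (negPf t0) [t *: 1]mulr1 addr0 exprS; apply: aux.
  exact: expf_neq0.
by rewrite pnatr_eq0.
Unshelve. all: by end_near. Qed.

(** The functions [hadamard_quot k] are the successive derivatives of the first one. The last clause
    tracks the order of vanishing, which drops by one. *)
Lemma hadamard : exists h : R^o -> R^o,
  [/\ smooth_on U h, forall t, U t -> f t = t * h t &
      forall k, derive1n k h 0 = derive1n k.+1 f 0 / k.+1%:R].
Proof.
have [] := @jets_smooth_on U hadamard_quot oU.
  move=> k t Ut; have [->|t0] := eqVneq t 0; first exact: hadamard_quot_derive0.
  exact: hadamard_quot_derive_neq0.
move=> hs hk; exists (hadamard_quot 0); split=> //.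
  move=> t Ut; rewrite /hadamard_quot; have [->|t0] := eqVneq t 0.
    by rewrite mul0r.
  by rewrite /= expr1 mulrC divfK.
by move=> k; rewrite hk // /hadamard_quot eqxx.
Qed.

End Hadamard.
End OneVariable.

(** * Order of vanishing and flatness at 0 *)

Section Order.
Context {R : realType}.
Variable U : set R^o.
Hypotheses (oU : open U) (U0 : U 0).
Implicit Types f g h : R^o -> R^o.

(** Hadamard's lemma is applied [j] times. The last clause is used contrapositively: if [j] is the
    exact order of vanishing, then [h 0] is nonzero. *)
Lemma factor_expr f j : smooth_on U f -> (forall l, (l < j)%N -> derive1n l f 0 = 0) ->
  exists h, [/\ smooth_on U h, forall t, U t -> f t = t ^+ j * h t &
                h 0 = 0 -> derive1n j f 0 = 0].
Proof.
elim: j f => [|j IH] f fs fl.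
  by exists f; split=> // t _; rewrite expr0 mul1r.
have [g [gs fg gk]] := hadamard oU U0 fs (fl 0%N isT).
have [|h [hs gh h0]] := IH g gs; first by move=> l lj; rewrite gk fl ?mul0r.
exists h; split=> // [t Ut|/h0 /eqP]; first by rewrite fg // gh // mulrA exprS.
by rewrite gk mulf_eq0 invr_eq0 pnatr_eq0 orbF => /eqP.
Qed.

(** The exponent [b] is the least order of vanishing in the family and [i0] is an index that attains
    it. *)
Lemma factor_expr_family (I : finType) (f : I -> R^o -> R^o) :
  (forall i, smooth_on U (f i)) -> (exists i j, derive1n j (f i) 0 != 0) ->
  exists b (h : I -> R^o -> R^o) i0,
  [/\ forall i, smooth_on U (h i), forall i t, U t -> f i t = t ^+ b * h i t,
      h i0 0 != 0, derive1n b (f i0) 0 != 0 &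
      forall i l, (l < b)%N -> derive1n l (f i) 0 = 0].
Proof.
move=> fs fn; pose P j := [exists i, derive1n j (f i) 0 != 0].
have exP : exists j, P j by have [i [j ij]] := fn; exists j; apply/existsP; exists i.
case: (ex_minnP exP) => b /existsP[i0 fi0] bmin.
have fl i l : (l < b)%N -> derive1n l (f i) 0 = 0.
  move=> lb; apply/eqP/negPn/negP => fil.
  by have := bmin l (introT existsP (ex_intro _ i fil)); rewrite leqNgt lb.
have /choice[h hP] i := factor_expr (fs i) (fl i).
exists b, h, i0; split=> //.
- by move=> i; case: (hP i).
- by move=> i; case: (hP i).
- by apply/eqP => h0; move/eqP: fi0; apply; case: (hP i0) => _ _; exact.
Qed.

Definition flat f := forall k, derive1n k f 0 = 0.

Lemma eq_flat f g : (forall t, U t -> f t = g t) -> flat f -> flat g.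
Proof. by move=> fg ff k; rewrite -(eq_on_derive1n k oU fg U0). Qed.

(** Flat functions form an ideal: in [f' g + f g'] each product again has a flat factor, so the
    induction on the order runs over all pairs at once. *)
Lemma flatM f g : smooth_on U f -> smooth_on U g -> flat f -> flat (f * g).
Proof.
move=> fs gs ff k; elim: k f g fs gs ff => [|k IH] f g fs gs ff.
  by have f0 : f 0 = 0 := ff 0%N; rewrite -[LHS]/(f 0 * g 0) f0 mul0r.
have dfs : smooth_on U (derive1 f : R^o -> R^o) := smooth_on_derive1n 1 fs.
have dgs : smooth_on U (derive1 g : R^o -> R^o) := smooth_on_derive1n 1 gs.
have dff : flat (derive1 f) by move=> l; rewrite -derive1Sn.
rewrite derive1Sn.
rewrite (eq_on_derive1n k oU (g := (derive1 f : R^o -> R^o) * g + f * derive1 g)) //.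
  rewrite (derive1nD_on k oU) ?IH ?addr0 //.
    exact: (smooth_onM oU dfs gs).
  exact: (smooth_onM oU fs dgs).
move=> t Ut; rewrite -[RHS]/(derive1 f t * g t + f t * derive1 g t) !derive1E.
rewrite deriveM; [|exact: smooth_on_derivable Ut..].
by rewrite addrC /GRing.scale /= (mulrC (g t)).
Qed.

Lemma flat_primitive f : f 0 = 0 -> flat (derive1 f) -> flat f.
Proof. by move=> f0 ff [|k] //; rewrite derive1Sn. Qed.

(** The derivative of [g / f] is the Wronskian over [f^2], hence flat; so [q = g/f - g(0)/f(0)] is
    flat, and so is [q f]. *)
Lemma flat_wronskian f g : smooth_on U f -> smooth_on U g ->
  (forall t, U t -> f t != 0) ->
  flat (f * derive1 g - g * derive1 f) -> flat (g - (g 0 / f 0) \*: f).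
Proof.
move=> fs gs f0 wf.
have dfs : smooth_on U (derive1 f : R^o -> R^o) := smooth_on_derive1n 1 fs.
have dgs : smooth_on U (derive1 g : R^o -> R^o) := smooth_on_derive1n 1 gs.
have fVs := smooth_onV oU fs f0.
pose q : R^o -> R^o := g * (fun t => (f t)^-1) + cst (- (g 0 / f 0)).
have qs : smooth_on U q.
  by apply: smooth_onD => //; [exact: smooth_onM|exact: smooth_on_cst].
have qf : flat q.
  apply: flat_primitive; first by rewrite /q /= -[LHS]/(g 0 / f 0 - g 0 / f 0) subrr.
  have Vs := smooth_onM oU fVs fVs.
  have ws := smooth_onB oU (smooth_onM oU fs dgs) (smooth_onM oU gs dfs).
  apply: eq_flat (flatM ws Vs wf) => t Ut.
  have df := smooth_on_derivable fs Ut (v := (1 : R^o)).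
  have dg := smooth_on_derivable gs Ut (v := (1 : R^o)).
  have dV := smooth_on_derivable fVs Ut (v := (1 : R^o)).
  rewrite /q derive1E (deriveD (derivableM dg dV) (derivable_cst _ _ _)).
  rewrite derive_cst addr0 (deriveM dg dV) (deriveV (f0 t Ut) df) -!derive1E.
  rewrite -[LHS]/((f t * derive1 g t - g t * derive1 f t) * ((f t)^-1 * (f t)^-1)).
  by rewrite /GRing.scale /=; field; exact: f0.
apply: eq_flat (flatM qs fs qf) => t Ut.
rewrite -[LHS]/((g t / f t - g 0 / f 0) * f t) -[RHS]/(g t - g 0 / f 0 * f t).
by rewrite mulrBl divfK ?f0.
Qed.

End Order.

(** * Projective charts and plane fields *)

Section LinearCoordinates.
Context {R : realType} {n : nat}.

Definition rv_coord (j : 'I_n) (x : 'rV[R]_n) : R^o := x 0 j.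

Fact rv_coord_is_linear j : linear (rv_coord j).
Proof. by move=> a x y; rewrite /rv_coord !mxE. Qed.

HB.instance Definition _ j :=
  GRing.isLinear.Build R 'rV[R]_n R^o *:%R (rv_coord j) (rv_coord_is_linear j).

Lemma rv_coord_continuous j : continuous (rv_coord j).
Proof. exact: coord_continuous. Qed.

Lemma smooth_on_rv_coord (U : set 'rV[R]_n) j : smooth_on U (rv_coord j).
Proof.
apply: (@smooth_on_sub _ _ _ (rv_coord j @^-1` setT)) => //.
apply: (@smooth_on_precomp _ _ _ _ setT (rv_coord j) (id : R^o -> R^o)).
  exact: rv_coord_continuous.
exact: smooth_id openT.
Qed.

Lemma smooth_on_pullback (U : set R^o) (f : R^o -> R^o) j : smooth_on U f ->
  smooth_on (rv_coord j @^-1` U) (fun x => f (x 0 j)).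
Proof.
move=> fs; apply: (@smooth_on_precomp _ _ _ _ U (rv_coord j)) fs.
exact: rv_coord_continuous.
Qed.

End LinearCoordinates.

Section Projective.
Context {R : realType} {m : nat}.
Implicit Types (g h : frame R m) (p : RP R m) (v : 'rV[R]_(1 + m)).

Definition proj_chart v : 'rV[R]_m := (lsubmx v 0 0)^-1 *: rsubmx v.

Lemma proj_chartZ a v : a != 0 -> proj_chart (a *: v) = proj_chart v.
Proof.
move=> a0; rewrite /proj_chart !linearZ /= mxE invfM scalerA.
by rewrite mulVKf.
Qed.

Lemma vpick_vline v : v != 0 -> exists2 a, a != 0 & vpick <[v]>%VS = a *: v.
Proof.
move=> v0; have /vlineP[a aE] := memv_pick <[v]>%VS.
exists a => //; apply: contra_neq v0 => a0; move: aE; rewrite a0 scale0r => /eqP.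
by rewrite vpick0 -dimv_eq0 dim_vline eqb0 negbK => /eqP.
Qed.

(** Charts are computed from the representative [vpick]; any other one differs by a nonzero factor,
    which cancels in the ratios. *)
Lemma line_chart g p v : v != 0 -> line p = <[v]>%VS ->
  (chart_dom g p <-> lsubmx (v *m frame_mx g) 0 0 != 0) /\
  chart g p = proj_chart (v *m frame_mx g).
Proof.
move=> v0 pE; rewrite /chart_dom /chart /homog /= pE.
have [a a0 ->] := vpick_vline v0.
rewrite -scalemxAl; split; last exact: proj_chartZ.
by rewrite linearZ /= mxE mulf_eq0 negb_or a0.
Qed.

Lemma RP_eq p q : line p = line q -> p = q.
Proof.
by case: p q => [l dl] [l' dl'] /= ll; subst l'; congr MkRP; exact: eq_irrelevance.
Qed.

Lemma affine_pt_chart g h (x : 'rV[R]_m) :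
  let v := row_mx 1%:M x *m invmx (frame_mx g) *m frame_mx h in
  (chart_dom h (affine_pt g x) <-> lsubmx v 0 0 != 0) /\
  chart h (affine_pt g x) = proj_chart v.
Proof. by apply: line_chart; [exact: affine_vec_neq0|]. Qed.

Lemma frame_mxK g (v : 'rV[R]_(1 + m)) : v *m invmx (frame_mx g) *m frame_mx g = v.
Proof. by case: g => g gU /=; rewrite mulmxKV. Qed.

Lemma frame_mxVK g (v : 'rV[R]_(1 + m)) : v *m frame_mx g *m invmx (frame_mx g) = v.
Proof. by case: g => g gU /=; rewrite mulmxK. Qed.

Lemma chart_affine_pt g x : chart g (affine_pt g x) = x.
Proof.
rewrite (affine_pt_chart g g x).2 frame_mxK /proj_chart row_mxKl row_mxKr.
by rewrite mxE eqxx invr1 scale1r.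
Qed.

Lemma chart_dom_affine_pt g x : chart_dom g (affine_pt g x).
Proof.
by apply/(affine_pt_chart g g x).1; rewrite frame_mxK row_mxKl mxE oner_eq0.
Qed.

Lemma homog_neq0 g p : vpick (line p) != 0.
Proof. by case: p => l /= dl; rewrite vpick0 -dimv_eq0 dl. Qed.

Lemma affine_ptK g p : chart_dom g p -> affine_pt g (chart g p) = p.
Proof.
rewrite /chart_dom /= => p0; apply: RP_eq => /=.
set b := lsubmx _ 0 0 in p0.
have vE : row_mx 1%:M (chart g p) = b^-1 *: homog g p.
  rewrite -[homog g p]hsubmxK scale_row_mx; congr row_mx.
  by apply/matrixP => i j; rewrite !ord1 mxE [RHS]mxE -/b mulVf.
rewrite vE -scalemxAl /homog frame_mxVK.
(* Both sides are lines, so one inclusion is enough. *)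
apply/eqP; rewrite eqEdim !dim_vline; apply/andP; split.
  by rewrite -memvE memvZ // memv_pick.
have -> : \dim (line p) = 1%N by case: (p).
by rewrite scaler_eq0 negb_or invr_eq0 p0 homog_neq0.
Qed.
End Projective.

Section ProjectiveSmooth.
Context {R : realType} {V : normedModType R} {m : nat}.
Variable U : set V.
Hypothesis oU : open U.

Lemma smooth_on_mulmxr n p q (A : V -> 'M[R]_(n, p)) (M : 'M[R]_(p, q)) :
  smooth_on U A -> smooth_on U (fun x => A x *m M).
Proof.
move=> As; apply/(smooth_on_mxP _ oU) => i j.
apply: (eq_smooth_on oU (f := \sum_k ((fun x => A x i k : R^o) * cst (M k j : R^o)))).
  by move=> x _; rewrite fct_sumE mxE.
apply: smooth_on_sum => // k; apply: smooth_onM => //; last exact: smooth_on_cst.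
by move/(smooth_on_mxP _ oU): As; exact.
Qed.

Lemma smooth_on_row_mx1 (x : V -> 'rV[R]_m) :
  smooth_on U x -> smooth_on U (fun y => row_mx 1%:M (x y) : 'rV[R]_(1 + m)).
Proof.
move=> xs; apply/(smooth_on_mxP _ oU) => i j; rewrite ord1.
case: (split_ordP j) => k ->.
  apply: (eq_smooth_on oU _ (smooth_on_cst oU 1)) => y _.
  by rewrite row_mxEl ord1 mxE eqxx.
move/(smooth_on_mxP _ oU): xs => /(_ 0 k); apply: (eq_smooth_on oU) => y _.
by rewrite row_mxEr.
Qed.

Lemma smooth_on_proj_chart (v : V -> 'rV[R]_(1 + m)) : smooth_on U v ->
  (forall x, U x -> lsubmx (v x) 0 0 != 0) -> smooth_on U (proj_chart \o v).
Proof.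
move=> /(smooth_on_mxP _ oU) vs v0; apply/(smooth_on_mxP _ oU) => i j.
have ls : smooth_on U (fun x => lsubmx (v x) 0 0 : R^o).
  by apply: (eq_smooth_on oU _ (vs 0 (lshift m 0))) => x _; rewrite mxE.
apply: (eq_smooth_on oU _ (smooth_onM oU (smooth_onV oU ls v0) (vs i (rshift 1 j)))).
move=> x _; rewrite /proj_chart /= [RHS]mxE [rsubmx _ _ _]mxE //.
Qed.

End ProjectiveSmooth.

Section Transition.
Context {R : realType} {m : nat}.

(** In homogeneous coordinates the transition map is an affine map [v] followed by [proj_chart],
    smooth on the open set [D] where the first coordinate of [v] is nonzero. *)
Lemma transition_differentiable (g h : frame R m) (x : 'rV[R]_m) :
  chart_dom h (affine_pt g x) -> differentiable (chart h \o affine_pt g) x.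
Proof.
move=> hx; pose v (y : 'rV[R]_m) : 'rV[R]_(1 + m) :=
  row_mx 1%:M y *m invmx (frame_mx g) *m frame_mx h.
have -> : chart h \o affine_pt g = @proj_chart R m \o v.
  by apply/funext => y; exact: (affine_pt_chart g h y).2.
have ids : smooth_on setT (id : 'rV[R]_m -> 'rV[R]_m).
  apply/(smooth_on_mxP _ openT) => i j; rewrite ord1.
  by apply: (eq_smooth_on openT _ (@smooth_on_rv_coord R m setT j)).
have vs : smooth_on setT v.
  apply: (smooth_on_mulmxr openT); apply: (smooth_on_mulmxr openT).
  refine (smooth_on_row_mx1 openT ids).
pose D := [set y | lsubmx (v y) 0 0 != 0].
have oD : open D.
  have ls : smooth_on setT (fun y => lsubmx (v y) 0 0 : R^o).
    move/(smooth_on_mxP _ openT): vs => /(_ 0 (lshift m 0)).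
    by apply: (eq_smooth_on openT) => y _; rewrite [RHS]mxE.
  apply: (@open_comp _ _ (fun y => lsubmx (v y) 0 0 : R^o) [set z | z != 0]).
    by move=> y _; apply: smooth_on_continuous ls _.
  exact: open_neq.
have Dx : D x by apply/(affine_pt_chart g h x).1.
have := smooth_on_proj_chart oD (smooth_on_sub (@subsetT _ D) vs) (fun y Dy => Dy).
by move/smooth_on_differentiable/(_ Dx).
Qed.

End Transition.

(** * A criterion for frontality inside one chart *)

Section Frontal.
Context {R : realType} {n m : nat}.

Lemma mulmx_row_inj (R' : nzSemiRingType) k l (A B : 'M[R']_(k, l)) :
  (forall v : 'rV_k, v *m A = v *m B) -> A = B.
Proof. by move=> AB; apply/row_matrixP => i; rewrite !rowE AB. Qed.

Lemma jacobian_comp p (f : 'rV[R]_n -> 'rV[R]_m) (T : 'rV[R]_m -> 'rV[R]_p) x :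
  differentiable f x -> differentiable T (f x) ->
  'J (T \o f) x = 'J f x *m 'J T (f x).
Proof.
move=> df dT; have dC := differentiable_comp df dT.
apply/row_matrixP => i; rewrite !rowE mulmxA -(deriveEjacobian _ dC).
rewrite -(deriveEjacobian _ df) -(deriveEjacobian _ dT).
by rewrite (deriveE _ dC) (deriveE _ df) (deriveE _ dT) diff_comp.
Qed.

Lemma near_eq_jacobian (f f' : 'rV[R]_n -> 'rV[R]_m) x :
  (\forall y \near x, f y = f' y) -> differentiable f x -> 'J f x = 'J f' x.
Proof.
move=> ff df; apply: mulmx_row_inj => v.
apply: etrans (esym (deriveEjacobian v df)) _.
apply: etrans (near_eq_derive v ff) _.
exact: deriveEjacobian (near_eq_differentiable ff df).
Qed.

Variables (U : set 'rV[R]_n) (g : frame R m) (f : 'rV[R]_n -> RP R m).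
Hypotheses (oU : open U) (Ug : forall x, U x -> chart_dom g (f x)).
Hypothesis fs : smooth_on U (chart g \o f).

(** Regularity is witnessed in some chart [h]. There the Jacobian is the one in [g] times that of
    the transition map, and a product has at most the rank of its left factor. *)
Lemma Reg_chart x : U x -> Reg f x -> \rank ('J (chart g \o f) x) = n.
Proof.
move=> Ux [h [hx rk]].
have df := smooth_on_differentiable fs Ux.
have near_fg : \forall y \near x,
    ((chart h \o affine_pt g) \o (chart g \o f)) y = (chart h \o f) y.
  apply: near_eq_on oU Ux _ => y Uy /=.
  by rewrite affine_ptK //; exact: Ug.
have dT : differentiable (chart h \o affine_pt g) ((chart g \o f) x).
  by apply: transition_differentiable => /=; rewrite affine_ptK //; exact: Ug.
have dC := differentiable_comp df dT.
apply/eqP; rewrite eqn_leq rank_leq_row /= -{1}rk.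
by rewrite -(near_eq_jacobian near_fg dC) jacobian_comp // mxrankM_maxl.
Qed.

Variables (s : 'I_n -> 'I_m) (A : 'rV[R]_n -> 'M[R]_(n, m)).
Hypotheses (U0 : U 0) (As : smooth_on U A).
Hypothesis AI : forall x, U x -> colsub s (A x) = 1%:M.
Hypothesis JA : forall x, U x -> ('J (chart g \o f) x <= A x)%MS.
Hypothesis dense_imm :
  U `<=` closure (U `&` [set x | \rank ('J (chart g \o f) x) = n]).

Lemma colsub_rank (B : 'M[R]_(n, m)) : colsub s B = 1%:M -> \rank B = n.
Proof.
move=> BI; apply/eqP; rewrite eqn_leq rank_leq_row /= -[X in (X <= _)%N](mxrank1 R n).
have -> : 1%:M = B *m colsub s 1%:M by rewrite mulmx_colsub mulmx1.
exact: mxrankM_maxl.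
Qed.

(** It suffices to have a smooth field of [n]-planes that contains the image of the differential: at
    regular points the dimensions agree, so inclusion is equality. *)
Lemma frontal_on_plane_field : frontal_on U f.
Proof.
split.
- move=> x; rewrite inE => Ux; exists g, U; split=> //.
- move=> x Ux; apply: closure_subset (dense_imm Ux) => y [Uy rk].
  by split => //; exists g; split => //; exact: Ug.
(* The field of planes has to be total; outside [U] it takes the plane at 0 as default value. *)
have planeP x : exists P : tplane R n m, U x ->
    [/\ base P = f x, tframe P = g & dirs P = <<A x>>%MS].
  have [Ux|nUx] := pselect (U x).
    have rk : \rank <<A x>>%MS = n by rewrite genmxE; exact/colsub_rank/AI.
    by exists (MkTplane (Ug Ux) rk).
  have rk : \rank <<A 0>>%MS = n by rewrite genmxE; exact/colsub_rank/AI.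
  by exists (MkTplane (Ug U0) rk).
have [F FP] := choice planeP; exists F; split.
- move=> x; rewrite inE => Ux; exists g, s, U; split=> //.
  + by move=> y Uy /=; have [-> _ _] := FP y Uy; exact: Ug.
  + by apply: (eq_smooth_on oU _ fs) => y Uy; have [-> _ _] := FP y Uy.
  + exists A; split=> // y; rewrite inE => Uy; split; first exact: AI.
    have [_ tE dE] := FP y Uy; rewrite /plane_in tE dE.
    (* The planes are recorded in [g] itself, so the change of chart is the identity. *)
    have -> : chart g \o affine_pt g = id.
      by apply/funext => z; exact: chart_affine_pt.
    have -> : 'J id (chart g (base (F y))) = 1%:M :> 'M[R]_m.
      apply/row_matrixP => i; rewrite !rowE -deriveEjacobian // derive_id.
      by rewrite mulmx1.
    by rewrite mulmx1; apply/eqmxP/eqmx_sym/genmxE.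
- move=> x; rewrite inE => -[Ux rx]; have [bE tE dE] := FP x Ux.
  rewrite /is_pushforward bE tE dE; split=> //.
  apply/eqmxP; apply: (eqmx_trans (genmxE _)); apply/eqmxP.
  have := mxrank_leqif_eq (JA Ux).
  rewrite Reg_chart // colsub_rank ?AI // => /leqif_refl.
  by rewrite andbC.
Qed.

End Frontal.

(** * Curves of finite type *)

Section CurveInChart.
Context {R : realType}.
Implicit Types (U : set R^o) (f : R^o -> R^o).

Lemma shrink_neq0 U f : open U -> U 0 -> smooth_on U f -> f 0 != 0 ->
  exists U', [/\ open U', U' 0, U' `<=` U & forall t, U' t -> f t != 0].
Proof.
move=> oU U0 fs f0.
have n0 : nbhs (0 : R^o) (f @^-1` [set z | z != 0]).
  have oz : open [set z : R | z != 0] by exact: open_neq.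
  by apply: (smooth_on_continuous fs U0); exact: open_nbhs_nbhs (conj oz f0).
exists (U `&` (f @^-1` [set z | z != 0])°); split => //.
  by apply: openI => //; exact: open_interior.
by move=> t tD; exact: (interior_subset (proj2 tD)).
Qed.

Section Matrix.
Variables (U : set R^o) (m n : nat) (c : R^o -> 'M[R]_(m, n)).
Hypotheses (oU : open U) (cs : smooth_on U c).

Lemma derive1n_mx k t i j : U t ->
  derive1n k c t i j = derive1n k (fun y => c y i j : R^o) t.
Proof.
elim: k t => // k IH t Ut; rewrite !derive1nS !derive1E.
rewrite -(eq_on_derive (1 : R^o) oU IH Ut) derive_mx ?mxE //.
by apply: smooth_on_derivable Ut; exact: smooth_on_derive1n.
Qed.

Lemma derive1n_mulmxr k t p (z : 'M[R]_(n, p)) i j : U t ->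
  (derive1n k c t *m z) i j = derive1n k (fun y => (c y *m z) i j : R^o) t.
Proof.
elim: k t => // k IH t Ut; rewrite !derive1nS !derive1E.
have ds := smooth_on_derive1n k cs.
rewrite -(eq_on_derive (1 : R^o) oU IH Ut) derive_mx; last first.
  exact: smooth_on_derivable ds Ut.
have dk l := (smooth_on_mxP _ oU).1 ds i l.
rewrite mxE (_ : (fun y => _) =
    \sum_l (fun y => derive1n k c y i l * z l j : R^o)); last first.
  by apply/funext => y; rewrite fct_sumE mxE.
have dl l : derivable (fun y => derive1n k c y i l : R^o) t (1 : R^o).
  exact: smooth_on_derivable (dk l) Ut.
rewrite derive_sum => [|l]; last exact: derivableM.
by apply: eq_bigr => l _; rewrite mxE deriveMr // mulrC.
Qed.

End Matrix.

(** * Velocity and Wronskians of a curve on which no nonzero linear form is flat *)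

Section Velocity.
Variables (U : set R^o) (m : nat) (c : R^o -> 'rV[R]_m).
Hypotheses (oU : open U) (U0 : U 0) (cs : smooth_on U c) (c0 : c 0 = 0).
Hypothesis nflat : forall l : 'cV[R]_m,
  flat (fun t => (c t *m l) 0 0 : R^o) -> l = 0.

Let cj (j : 'I_m) : R^o -> R^o := fun t => c t 0 j.

Lemma coord_smooth j : smooth_on U (cj j).
Proof. by move/(smooth_on_mxP _ oU): cs; exact. Qed.

(** The index [i] guarantees a coordinate: were every [c_j'] flat, [c_i] would be flat too, as
    [c 0 = 0]. The last two clauses identify [b.+1] with [a_1]. *)
Lemma velocity_factor (i : 'I_m) : exists b (e : 'I_m -> R^o -> R^o) i0,
  [/\ forall j, smooth_on U (e j),
      forall j t, U t -> derive1 (cj j) t = t ^+ b * e j t,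
      e i0 0 != 0, derive1n b.+1 (cj i0) 0 != 0 &
      forall j l, (l <= b)%N -> derive1n l (cj j) 0 = 0].
Proof.
have [||b [e [i0 [es eE e0 d0 dl]]]] :=
    @factor_expr_family R U oU U0 'I_m (fun j => derive1 (cj j)).
- by move=> j; exact: (smooth_on_derive1n 1 (coord_smooth j)).
- apply: contrapT => nex.
  have : delta_mx i 0 = 0 :> 'cV[R]_m.
    have lE : (fun t => (c t *m (delta_mx i 0 : 'cV_m)) 0 0) = cj i.
      by apply: funext => t; rewrite -colE mxE.
    apply: nflat; rewrite lE; apply: flat_primitive; first by rewrite /cj c0 mxE.
    by move=> k; apply/eqP/negPn/negP => ik; apply: nex; exists i, k.
  by move=> /matrixP/(_ i 0); rewrite !mxE !eqxx => /eqP; rewrite oner_eq0.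
exists b, e, i0; split=> // [|j [|l] lb]; first by rewrite derive1Sn.
- by rewrite /= /cj c0 mxE.
- by rewrite derive1Sn dl.
Qed.

(** Column [j] of [Wmx] holds the derivative of order [j+1], so the first [b] columns vanish and the
    next one does not: the rank jumps from 0 to 1 at [b.+1]. *)
Lemma type_entry1 b i0 : derive1n b.+1 (cj i0) 0 != 0 ->
  (forall j l, (l <= b)%N -> derive1n l (cj j) 0 = 0) ->
  type_entry c 0 1 = b.+1.
Proof.
move=> d0 dl.
have WE k i (j : 'I_k) : Wmx c k 0 i j = derive1n j.+1 (cj i) 0.
  by rewrite mxE (derive1n_mx oU cs).
have W0 k : (k <= b)%N -> Wmx c k 0 = 0.
  by move=> kb; apply/matrixP => i j; rewrite WE mxE dl // (leq_trans (ltn_ord j)).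
have Wb : \rank (Wmx c b.+1 0) = 1%N.
  apply/eqP; rewrite eqn_leq; apply/andP; split.
    (* Only the last column can be nonzero, so the matrix is a column times a row. *)
    have -> : Wmx c b.+1 0 = col ord_max (Wmx c b.+1 0) *m delta_mx 0 ord_max.
      apply/matrixP => i j; rewrite [RHS]mxE big_ord1 [col _ _ _ _]mxE.
      rewrite [delta_mx _ _ _ _]mxE eqxx /=.
      have [->|jb] := eqVneq j ord_max; first by rewrite mulr1.
      rewrite mulr0 WE dl // ltn_neqAle -ltnS ltn_ord andbT.
      by apply: contra_neq jb => jb; apply: val_inj.
    exact: leq_trans (mxrankM_maxl _ _) (rank_leq_col _).
  rewrite lt0n mxrank_eq0; apply: contra_neq d0 => /matrixP/(_ i0 ord_max).
  by rewrite WE mxE.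
rewrite /type_entry; apply: xget_unique.
  split=> // k rk; rewrite ltnNge; apply/negP => /W0 Wk.
  by move: rk; rewrite Wk mxrank0.
move=> k [rk kmin]; apply/eqP; rewrite eqn_leq kmin // ltnNge.
by apply/negP => /W0 Wk; move: rk; rewrite Wk mxrank0.
Qed.

(** Off 0 the power [t^b] cancels; at 0 the limit is the value of the continuous [e]. *)
Lemma tangent_dirE b (e : 'I_m -> R^o -> R^o) : type_entry c 0 1 = b.+1 ->
  (forall j, smooth_on U (e j)) ->
  (forall j t, U t -> derive1 (cj j) t = t ^+ b * e j t) ->
  forall t, U t -> tangent_dir c t = \row_j e j t.
Proof.
move=> tE es eE.
have qE t : U t -> t != 0 -> (t ^+ b)^-1 *: derive1 c t = \row_j e j t.
  move=> Ut t0; apply/rowP => j; rewrite !mxE (derive1n_mx oU cs 1 0 j Ut).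
  by rewrite -[derive1n 1 _ t]/(derive1 (cj j) t) eE // mulKf // expf_neq0.
move=> t Ut; rewrite /tangent_dir tE /=; have [t0|t0] := eqVneq t 0; last exact: qE.
rewrite t0; apply: cvg_lim => //.
have ev : smooth_on U (fun t : R^o => \row_j e j t).
  by apply/(smooth_on_mxP _ oU) => i j; under eq_fun do rewrite mxE; exact: es.
have /continuous_withinNx := smooth_on_continuous ev U0.
apply: cvg_trans; apply: near_eq_cvg; near=> r.
have r0 : r != 0 by near: r; exact: nbhs_dnbhs_neq.
rewrite qE //; near: r; apply: nbhs_dnbhs.
exact: open_nbhs_nbhs.
Unshelve. all: by end_near. Qed.

(** If all Wronskians against [e i0] were flat, so would be [e i1 - r e i0] for
    [r = e i1 0 / e i0 0]. Times [t^b] this is the derivative of [c_i1 - r c_i0], which would then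
    be a flat linear form. *)
Lemma wronskian_factor b (e : 'I_m -> R^o -> R^o) i0 i1 : i1 != i0 ->
  (forall j, smooth_on U (e j)) ->
  (forall j t, U t -> derive1 (cj j) t = t ^+ b * e j t) ->
  (forall t, U t -> e i0 t != 0) ->
  exists b' (w : 'I_m -> R^o -> R^o) j0,
  [/\ forall j, smooth_on U (w j),
      forall j t, U t ->
        e i0 t * derive1 (e j) t - e j t * derive1 (e i0) t = t ^+ b' * w j t,
      forall t, w i0 t = 0 & w j0 0 != 0].
Proof.
move=> i10 es eE e0.
have des j : smooth_on U (derive1 (e j) : R^o -> R^o) := smooth_on_derive1n 1 (es j).
pose W j : R^o -> R^o := e i0 * derive1 (e j) - e j * derive1 (e i0).
have Ws j : smooth_on U (W j).
  exact: (smooth_onB oU (smooth_onM oU (es i0) (des j)) (smooth_onM oU (es j) (des i0))).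
have W0 t : W i0 t = 0 by rewrite -[W i0 t]/(e i0 t * _ - e i0 t * _) subrr.
have [|b' [w [j0 [ws wE w0 d0 _]]]] := factor_expr_family oU U0 Ws.
  apply: contrapT => nex.
  have fW : flat (W i1).
    by move=> k; apply/eqP/negPn/negP => ik; apply: nex; exists i1, k.
  have := flat_wronskian oU U0 (es i0) (es i1) e0 fW.
  set r := e i1 0 / e i0 0 => fe.
  have ss : smooth_on U (e i1 - r \*: e i0).
    apply: (smooth_onB oU (es i1)).
    exact: (smooth_onM oU (smooth_on_cst oU r) (es i0)).
  have ft := flatM oU U0 ss (smooth_expr b oU) fe.
  pose l : 'cV[R]_m := delta_mx i1 0 - r *: delta_mx i0 0.
  have lE t : (c t *m l) 0 0 = cj i1 t - r * cj i0 t.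
    by rewrite mulmxBr -scalemxAr -!colE !mxE.
  have : l = 0.
    apply: nflat; apply: flat_primitive; first by rewrite c0 mul0mx mxE.
    apply: (eq_flat oU U0 _ ft) => t Ut.
    have {}lE : (fun t => (c t *m l) 0 0) = cj i1 - r \*: cj i0.
      by apply/funext => y; exact: lE.
    rewrite lE.
    have dc j := smooth_on_derivable (coord_smooth j) Ut (v := (1 : R^o)).
    rewrite derive1E (deriveB (dc i1) (derivableZ (dc i0))) deriveZ //.
    rewrite -!derive1E !eE //.
    by rewrite -[LHS]/((e i1 t - r * e i0 t) * t ^+ b) /GRing.scale /=; ring.
  move/matrixP/(_ i1 0); rewrite !mxE !eqxx (negPf i10) mulr0 subr0 => /eqP.
  by rewrite oner_eq0.
(* The component [i0] is reset to the zero function, matching its vanishing Wronskian at every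
   [t]. *)
exists b', (fun j => if j == i0 then cst 0 else w j), j0; split.
- by move=> j; case: ifP => _ //; exact: smooth_on_cst.
- move=> j t Ut; have [->|_] := eqVneq j i0; first by rewrite mulr0 subrr.
  exact: wE.
- by move=> t; rewrite eqxx.
(* The Wronskian of index [j0] has a nonzero derivative at 0, whereas the one of index [i0] is
   identically zero. *)
- have [j00|//] := eqVneq j0 i0; move: d0; rewrite j00.
  rewrite (eq_on_derive1n b' oU (g := cst 0)) //.
  suff -> : derive1n b' (cst 0 : R^o -> R^o) 0 = 0 by rewrite eqxx.
  elim: b' {wE} => // k; rewrite derive1Sn => IH.
  suff -> : derive1 (cst 0 : R^o -> R^o) = cst 0 by [].
  by apply/funext => y; rewrite derive1_cst.
Qed.

End Velocity.
End CurveInChart.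

(** * Homogeneous lifts and independence of the centred chart *)

Section Lift.
Context {R : realType} {m : nat}.
Implicit Types (U : set R^o) (gamma : R^o -> RP R m) (v : R^o -> 'rV[R]_(1 + m)).

Definition rv1 (t : R^o) : 'rV[R]_1 := const_mx t.

Fact rv1_is_linear : linear rv1.
Proof. by move=> a x y; apply/matrixP => i j; rewrite !mxE. Qed.

HB.instance Definition _ :=
  GRing.isLinear.Build R R^o 'rV[R]_1 *:%R rv1 rv1_is_linear.

Lemma rv1_continuous : continuous rv1.
Proof.
move=> t; have -> : rv1 = (fun t : R^o => t *: const_mx 1).
  by apply/funext => y; apply/matrixP => i j; rewrite !mxE mulr1.
exact: scalel_continuous.
Qed.

Lemma smooth_germ_lift gamma : smooth_germ (curve_map gamma) ->
  exists U v, [/\ open U, U 0, smooth_on U v &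
    forall t, U t -> v t != 0 /\ line (gamma t) = <[v t]>%VS].
Proof.
move=> [U0 [_ U00 /(_ 0)]]; rewrite inE => /(_ U00) [g [V [oV V0 Vg Vs]]].
pose U : set R^o := rv1 @^-1` V.
have oU : open U by apply: open_comp oV => t _; exact: rv1_continuous.
have gE t : curve_map gamma (rv1 t) = gamma t by rewrite /curve_map mxE.
have cs : smooth_on U (fun t : R^o => chart g (gamma t)).
  apply: (eq_smooth_on oU _ (smooth_on_precomp rv1_continuous Vs)) => t _ /=.
  by rewrite gE.
exists U, (fun t => row_mx 1%:M (chart g (gamma t)) *m invmx (frame_mx g)).
split=> //.
  by apply: smooth_on_mulmxr => //; exact: smooth_on_row_mx1.
move=> t /Vg /=; rewrite gE => /affine_ptK gt.
by split; [exact: affine_vec_neq0|rewrite -{1}gt].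
Qed.

(** The factor [phi] is the first homogeneous coordinate of the lift in [g]; dividing by it recovers
    the affine coordinates. *)
Lemma lift_chart gamma U v g : open U -> U 0 -> smooth_on U v ->
  (forall t, U t -> v t != 0 /\ line (gamma t) = <[v t]>%VS) ->
  chart_dom g (gamma 0) ->
  exists (U' : set R^o) (phi : R^o -> R^o), [/\ [/\ open U', U' 0 & U' `<=` U],
    forall t, U' t -> chart_dom g (gamma t),
    smooth_on U' (chart g \o gamma),
    smooth_on U' phi /\ (forall t, U' t -> phi t != 0) &
    forall t, U' t -> v t *m frame_mx g = phi t *: row_mx 1%:M (chart g (gamma t))].
Proof.
move=> oU U0 vs vl g0; have [v0 vE0] := vl 0 U0.
pose phi (t : R^o) : R^o := lsubmx (v t *m frame_mx g) 0 0.
have vgs := smooth_on_mulmxr oU (frame_mx g) vs.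
have phis : smooth_on U phi.
  apply: (eq_smooth_on oU _ ((smooth_on_mxP _ oU).1 vgs 0 (lshift m 0))) => t _.
  by rewrite [RHS]mxE.
have phi0 : phi 0 != 0 by apply/((line_chart g v0 vE0).1).
have [U' [oU' U'0 UU' phiN]] := shrink_neq0 oU U0 phis phi0.
have cE t : U' t -> chart g (gamma t) = proj_chart (v t *m frame_mx g).
  by move=> /UU' /vl [vt0 vE]; have [_ ->] := line_chart g vt0 vE.
exists U', phi; split=> //.
- move=> t Ut; have [vt0 vE] := vl t (UU' t Ut).
  by apply/(line_chart g vt0 vE).1; exact: phiN.
- apply: (eq_smooth_on oU' _ (smooth_on_proj_chart oU' (smooth_on_sub UU' vgs) phiN)).
  by move=> t Ut /=; rewrite cE.
- by split => //; exact: smooth_on_sub phis.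
- move=> t Ut; rewrite -[LHS]hsubmxK scale_row_mx cE //; congr row_mx.
    by apply/matrixP => i j; rewrite !ord1 [RHS]mxE [X in _ * X]mxE eqxx mulr1.
  by rewrite scalerA mulfV ?scale1r //; exact: phiN.
Qed.

(** Finite type is given in one centred chart [h] and needed in another, [g]. The statement that
    travels is that no nonzero linear form is flat on the lift [v]. *)
Lemma finite_type_chart gamma g :
  smooth_germ (curve_map gamma) -> finite_type gamma 0 -> centred g (gamma 0) ->
  exists U, [/\ open U, U 0, forall t, U t -> chart_dom g (gamma t),
    smooth_on U (chart g \o gamma) &
    forall l : 'cV[R]_m, flat (fun t => (chart g (gamma t) *m l) 0 0) -> l = 0].
Proof.
move=> /smooth_germ_lift[U [v [oU U0 vs vl]]] [h [[hd h0] [k rk]]] [gd g0].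
have vnf (y : 'cV[R]_(1 + m)) : flat (fun t => (v t *m y) 0 0) -> y = 0.
  have [U' [phi [[oU' U'0 UU'] _ cs [phis phi0] vE]]] := lift_chart oU U0 vs vl hd.
  move=> vf; pose z := invmx (frame_mx h) *m y.
  suff z0 : z = 0.
    have hU : frame_mx h \in unitmx by case: (h).
    by rewrite -[y](mulKVmx hU) -/z z0 mulmx0.
  pose c t := chart h (gamma t).
  have vys : smooth_on U' (fun t => (v t *m y) 0 0 : R^o).
    exact: ((smooth_on_mxP _ oU').1 (smooth_on_sub UU' (smooth_on_mulmxr oU y vs)) 0 0).
  (* Divided by [phi], the form [y] becomes an affine function of the coordinates in [h]; its
     constant term is its value at the centre, hence zero by flatness. *)
  have zE t : U' t -> (v t *m y) 0 0 / phi t =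
      usubmx z 0 0 + (c t *m dsubmx z) 0 0.
    move=> Ut; have -> : v t *m y = v t *m frame_mx h *m z.
      by rewrite /z mulmxA frame_mxVK.
    rewrite vE // -scalemxAl [X in X / _]mxE -[z in LHS]vsubmxK mul_row_col mul1mx.
    by rewrite [X in _ * X / _]mxE mulrAC mulfV ?mul1r //; exact: phi0.
  have ff := eq_flat oU' U'0 zE (flatM oU' U'0 vys (smooth_onV oU' phis phi0) vf).
  have zu : usubmx z 0 0 = 0.
    have : usubmx z 0 0 + (c 0 *m dsubmx z) 0 0 = 0 := ff 0%N.
    by rewrite /c h0 mul0mx [X in _ + X]mxE addr0.
  have fz : flat (fun t => (c t *m dsubmx z) 0 0).
    move=> l; rewrite -[RHS](ff l); congr (derive1n l _ 0).
    by apply/funext => t; rewrite zu add0r.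
  (* The linear part annihilates every column of a matrix of rank [m], so it vanishes. *)
  have zd : (dsubmx z)^T *m Wmx (chart h \o gamma) k 0 = 0.
    apply/rowP => j; rewrite [RHS]mxE -[RHS](fz j.+1).
    rewrite -(derive1n_mulmxr oU' cs j.+1 (dsubmx z) 0 0 U'0) !mxE.
    by apply: eq_bigr => i _; rewrite !mxE mulrC.
  have : (dsubmx z)^T == 0.
    by rewrite -(mulmx_free_eq0 _ (B := Wmx (chart h \o gamma) k 0)) ?zd // /row_free rk.
  rewrite trmx_eq0 => /eqP dz; rewrite -[z]vsubmxK dz.
  apply/colP => i; rewrite [RHS]mxE; case: (split_ordP i) => j ->.
    by rewrite col_mxEu ord1 zu.
  by rewrite col_mxEd mxE.
have [U' [phi [[oU' U'0 UU'] gdom cs [phis phi0] vE]]] := lift_chart oU U0 vs vl gd.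
exists U'; split=> // l lf.
have gU : frame_mx g \in unitmx by case: (g).
(* A linear form in the affine coordinates of [g] is a homogeneous one without first coefficient. *)
pose z : 'cV[R]_(1 + m) := col_mx 0 l.
suff : frame_mx g *m z = 0.
  by move/(congr1 (mulmx (invmx (frame_mx g)))); rewrite mulKmx // mulmx0 =>
    /(congr1 dsubmx); rewrite col_mxKd linear0.
apply: vnf.
have ls : smooth_on U' (fun t => (chart g (gamma t) *m l) 0 0 : R^o).
  exact: ((smooth_on_mxP _ oU').1 (smooth_on_mulmxr oU' l cs) 0 0).
apply: (eq_flat oU' U'0 _ (flatM oU' U'0 ls phis lf)) => t Ut.
rewrite mulmxA vE // -scalemxAl mul_row_col mulmx0 add0r [RHS]mxE.
by rewrite mulrC.
Qed.

End Lift.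

Section Pullback.
Context {R : realType} {n : nat}.

Lemma open_pullback (U : set R^o) j : open U -> open (@rv_coord R n j @^-1` U).
Proof. by apply: open_comp => x _; exact: rv_coord_continuous. Qed.

Lemma derive_pullback (f : R^o -> R^o) (j : 'I_n) v (x : 'rV[R]_n) :
  differentiable f (x 0 j) ->
  'D_v (fun y : 'rV[R]_n => f (y 0 j) : R^o) x = v 0 j * derive1 f (x 0 j).
Proof.
move=> df; apply: etrans (derive_precomp (rv_coord j) f v x) _.
by apply: etrans (deriveE _ df) _; rewrite diff1E.
Qed.

Lemma jacobianE m (f : 'rV[R]_n -> 'rV[R]_m) x i j : differentiable f x ->
  'J f x i j = 'D_(delta_mx 0 i) (fun y => f y 0 j : R^o) x.
Proof.
move=> df; have -> : 'J f x i j = ((delta_mx 0 i : 'rV_n) *m 'J f x) 0 j.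
  by rewrite -rowE [RHS]mxE.
apply: etrans (congr1 (fun M : 'rV_m => M 0 j) (esym (deriveEjacobian _ df))) _.
by rewrite derive_mx ?mxE //; exact: diff_derivable.
Qed.

(** Moving from [x] along the diagonal, each coordinate vanishes for only one value of the
    parameter. *)
Lemma dense_neq0_coords (U : set 'rV[R]_n) : open U ->
  U `<=` closure (U `&` [set x | forall j, x 0 j != 0]).
Proof.
move=> oU x Ux B Bx.
have UB : nbhs x (U `&` B) by apply: filterI => //; exact: open_nbhs_nbhs.
have yx : x + t *: const_mx 1 @[t --> (0 : R^o)] --> x.
  rewrite -[X in _ --> X]addr0 -(scale0r (const_mx 1)).
  apply: cvgD; first exact: cvg_cst.
  exact: (@scalel_continuous _ _ (const_mx 1 : 'rV[R]_n) 0).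
have jN (j : 'I_n) : \forall t \near (0 : R^o)^', x 0 j + t != 0.
  have [->|xj] := eqVneq (x 0 j) 0.
    by near=> t; rewrite add0r; near: t; exact: nbhs_dnbhs_neq.
  have oN : open [set z : R | z != - x 0 j] by exact: open_neq.
  have N0 : nbhs (0 : R^o) [set z : R^o | z != - x 0 j].
    by apply: open_nbhs_nbhs; split=> //=; rewrite eq_sym oppr_eq0.
  by apply: nbhs_dnbhs; apply: (@filterS R^o _ _ _ _ _ N0) => t /=; rewrite addrC addr_eq0.
have H : \forall t \near (0 : R^o)^',
    (forall j, x 0 j + t != 0) /\ (U `&` B) (x + t *: const_mx 1).
  by apply: filterS2 (filter_forall _ jN) (nbhs_dnbhs (yx _ UB)) => t; split.
have [t [tN [Ut Bt]]] := filter_ex H.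
exists (x + t *: const_mx 1); split=> //; split=> // j /=.
by rewrite !mxE mulr1.
Unshelve. all: by end_near. Qed.

End Pullback.

(** * Frontality *)

Lemma ord2_neq0 (k : 'I_2) : k != 0 -> k = 1.
Proof. by case: k => [[|[|]]] // k2 _; exact: val_inj. Qed.

Lemma sum_ord2 (V : zmodType) (f : 'I_2 -> V) : \sum_k f k = f 0 + f 1.
Proof.
rewrite !big_ord_recl big_ord0 addr0; congr (_ + f _); exact: val_inj.
Qed.

Lemma det_ord2 (K : comNzRingType) (B : 'M[K]_2) :
  \det B = B 0 0 * B 1 1 - B 0 1 * B 1 0.
Proof.
have l0 : lift 0 0 = 1 :> 'I_2 by exact: val_inj.
have l1 : lift 1 0 = 0 :> 'I_2 by exact: val_inj.
rewrite (expand_det_row _ 0) sum_ord2 /cofactor !det_mx11 !mxE l0 l1 /=.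
by rewrite expr0 expr1 mul1r mulN1r mulrN.
Qed.

(** Here [x, y, u] stand for [e_j, e_j0, e_i0] and [z, v] for [w_j, w_j0]: this expands the
    [s]-derivative of the tangent map in the basis [A] of the plane. *)
Lemma tangent_row0 (K : fieldType) (x y u z v : K) : u != 0 -> v != 0 ->
  x = u * (x / u - y / u * (z / v)) + y * (z / v).
Proof. by move=> u0 v0; field; rewrite u0 v0. Qed.

(** The same for the [t]-derivative, with [T = t^b], [p = t^b'], [d = e_i0'] and each [e_j']
    expressed through [w_j]. *)
Lemma tangent_row1 (K : fieldType) (T s p d x y u z v : K) : u != 0 -> v != 0 ->
  T * x + s * ((p * z + x * d) / u) =
  (T * u + s * d) * (x / u - y / u * (z / v)) +
  (T * y + s * ((p * v + y * d) / u)) * (z / v).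
Proof. by move=> u0 v0; field; rewrite u0 v0. Qed.

(** The minor of the Jacobian in columns [i0] and [j0] is [s] times a Wronskian. *)
Lemma tangent_det (K : comNzRingType) (T s u y du dy : K) :
  u * (T * y + s * dy) - y * (T * u + s * du) = s * (u * dy - y * du).
Proof. by ring. Qed.

Section FrontalGerms.
Context {R : realType} {m : nat}.
Variables (gamma : R^o -> RP R m) (g : frame R m) (U : set R^o).
Hypotheses (oU : open U) (U0 : U 0).
Hypothesis gdom : forall t, U t -> chart_dom g (gamma t).
Let c : R^o -> 'rV[R]_m := chart g \o gamma.
Hypotheses (cs : smooth_on U c) (c0 : c 0 = 0).
Hypothesis nflat : forall l : 'cV[R]_m, flat (fun t => (c t *m l) 0 0) -> l = 0.

Let cj (j : 'I_m) : R^o -> R^o := fun t => c t 0 j.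

Let diff_on (V : set R^o) (f : R^o -> R^o) t : smooth_on V f -> V t ->
  differentiable f t := fun fs Vt => smooth_on_differentiable fs Vt.

Lemma curve_frontal (i : 'I_m) : frontal_germ (curve_map gamma).
Proof.
have [b [e [i0 [es eE e00 _ _]]]] := velocity_factor oU U0 cs c0 nflat i.
have [U' [oU' U'0 UU' e0]] := shrink_neq0 oU U0 (es i0) e00.
pose V : set 'rV[R]_1 := rv_coord 0 @^-1` U'.
have oV : open V by exact: open_pullback.
have V0 : V 0 by rewrite /V /= /rv_coord mxE.
(* The direction [e] scaled to have entry 1 at [i0]; the Jacobian is [t^b e_i0] times it, hence
   nonzero for [t != 0]. *)
pose A (x : 'rV[R]_1) : 'M[R]_(1, m) := \row_j (e j (x 0 0) / e i0 (x 0 0)).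
have Vgs : smooth_on V (chart g \o curve_map gamma).
  apply/(smooth_on_mxP _ oV) => k j; rewrite ord1.
  apply: (@smooth_on_pullback _ _ U' (cj j)).
  exact: coord_smooth oU' (smooth_on_sub UU' cs) j.
have JE x : V x -> 'J (chart g \o curve_map gamma) x =
    (x 0 0 ^+ b * e i0 (x 0 0)) *: A x.
  move=> Vx; apply/matrixP => k j; rewrite ord1.
  have dF := smooth_on_differentiable Vgs Vx.
  rewrite (jacobianE _ _ dF) (@derive_pullback _ _ (cj j)); last first.
    exact: diff_on (coord_smooth oU cs j) (UU' _ Vx).
  rewrite eE; last exact: UU'.
  rewrite !mxE !eqxx mul1r -[RHS]mulrA; congr (_ * _).
  by rewrite mulrC divfK // e0.
have AI x : V x -> colsub (fun _ : 'I_1 => i0) (A x) = 1%:M.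
  move=> Vx; apply/matrixP => k l; rewrite !ord1 !mxE eqxx divff //.
  exact: e0.
exists V; split=> //.
apply: (@frontal_on_plane_field _ _ _ V g _ oV _ Vgs (fun _ => i0) A) => //.
- by move=> x Vx; exact/gdom/UU'.
- apply/(smooth_on_mxP _ oV) => k j.
  apply: (eq_smooth_on oV (f := (fun x : 'rV_1 => e j (x 0 0)) *
                                (fun x : 'rV_1 => (e i0 (x 0 0))^-1))).
    by move=> x _; rewrite mxE.
  apply: smooth_onM => //.
    by apply: (@smooth_on_pullback _ _ U' (e j)); exact: smooth_on_sub (es j).
  apply: (@smooth_on_pullback _ _ U' (fun t => (e i0 t)^-1)).
  by apply: smooth_onV => //; exact: smooth_on_sub (es i0).
- by move=> x Vx; rewrite JE // scalemx_sub.
- move=> x Vx; apply: closure_subset (dense_neq0_coords oV Vx) => y [Vy yN].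
  split=> //=; rewrite JE // (eqmx_scale _ _).1 //; last first.
    by rewrite mulf_neq0 ?expf_neq0 ?yN //; exact: e0.
  exact: colsub_rank (AI y Vy).
Qed.

(** Two distinct indices provide the pair [i0, i1] for the Wronskian. The plane spanned by [e] and
    [w] depends on [t] only, so [V] leaves [s] free. *)
Lemma Tan_frontal (i i' : 'I_m) : i' != i -> frontal_germ (Tan g gamma).
Proof.
move=> ii'.
have [b [e [i0 [es eE e00 d0 dl]]]] := velocity_factor oU U0 cs c0 nflat i.
have tE := type_entry1 oU U0 cs d0 dl.
have tdE := tangent_dirE oU U0 cs tE es eE.
have [U1 [oU1 U10 UU1 e0]] := shrink_neq0 oU U0 (es i0) e00.
have cs1 := smooth_on_sub UU1 cs.
have es1 j := smooth_on_sub UU1 (es j).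
have eE1 j t (Ut : U1 t) := eE j t (UU1 t Ut).
have [i1 i10] : exists i1, i1 != i0.
  by have [<-|?] := eqVneq i' i0; [exists i; rewrite eq_sym|exists i'].
have [b' [w [j0 [ws wE wi0 wj0]]]] :=
  wronskian_factor oU1 U10 cs1 c0 nflat i10 es1 eE1 e0.
have [U2 [oU2 U20 UU2 w0]] := shrink_neq0 oU1 U10 (ws j0) wj0.
have j00 : j0 != i0 by apply: contra_neq wj0 => ->.
have U2U t : U2 t -> U t by move=> /UU2/UU1.
pose V : set 'rV[R]_2 := rv_coord 1 @^-1` U2.
have oV : open V by exact: open_pullback.
have V0 : V 0 by rewrite /V /= /rv_coord mxE.
have pb (f : R^o -> R^o) : smooth_on U2 f ->
    smooth_on V (fun x : 'rV[R]_2 => f (x 0 1)).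
  by move=> fs; exact: (@smooth_on_pullback _ _ U2 f).
have es2 j : smooth_on U2 (e j) by apply: smooth_on_sub (es1 j).
have ws2 j : smooth_on U2 (w j) by apply: smooth_on_sub (ws j).
have cs2 j : smooth_on U2 (cj j) by apply: smooth_on_sub (coord_smooth oU cs j).
have eVs : smooth_on U2 (fun t => (e i0 t)^-1).
  by apply: smooth_onV => // t /UU2; exact: e0.
have wVs : smooth_on U2 (fun t => (w j0 t)^-1) by exact: smooth_onV.
have xs : smooth_on V (fun x => x 0 0 : R^o) by exact: smooth_on_rv_coord.
pose s (k : 'I_2) := if k == 0 then i0 else j0.
(* The reduced basis of the span of [e] and [w]: since [w_i0 = 0], clearing column [j0] of
   [e / e_i0] gives the identity in columns [i0, j0]. *)
pose A (x : 'rV[R]_2) : 'M[R]_(2, m) := \matrix_(k, j)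
  let t := x 0 1 in
  if k == 0 then e j t / e i0 t - e j0 t / e i0 t * (w j t / w j0 t)
  else w j t / w j0 t.
have TE j x : V x ->
    (chart g \o Tan g gamma) x 0 j = cj j (x 0 1) + x 0 0 * e j (x 0 1).
  move=> Vx; rewrite /= chart_affine_pt tdE; last exact: U2U.
  by rewrite [LHS]mxE [X in _ + X]mxE [(\row_j0 _) _ _]mxE.
have Fs : smooth_on V (chart g \o Tan g gamma).
  apply/(smooth_on_mxP _ oV) => k j; rewrite ord1.
  apply: (eq_smooth_on oV _ (smooth_onD oV (pb _ (cs2 j))
                              (smooth_onM oV xs (pb _ (es2 j))))).
  by move=> x Vx; rewrite TE.
have JE x k j : V x -> 'J (chart g \o Tan g gamma) x k j =
    if k == 0 then e j (x 0 1)
    else x 0 1 ^+ b * e j (x 0 1) + x 0 0 * derive1 (e j) (x 0 1).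
  move=> Vx; have dF := smooth_on_differentiable Fs Vx.
  rewrite (jacobianE _ _ dF) (eq_on_derive _ oV (TE j) Vx).
  have dc := diff_on (cs2 j) Vx; have de := diff_on (es2 j) Vx.
  have dc' := smooth_on_derivable (pb _ (cs2 j)) Vx (v := delta_mx 0 k).
  have de' := smooth_on_derivable (pb _ (es2 j)) Vx (v := delta_mx 0 k).
  have dx := smooth_on_derivable xs Vx (v := delta_mx 0 k).
  have -> : (fun y : 'rV[R]_2 => cj j (y 0 1) + y 0 0 * e j (y 0 1) : R^o) =
      (fun y : 'rV[R]_2 => cj j (y 0 1)) +
      (fun y : 'rV[R]_2 => y 0 0 : R^o) * (fun y : 'rV[R]_2 => e j (y 0 1)) by [].
  rewrite (deriveD dc' (derivableM dx de')) (deriveM dx de').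
  rewrite (derive_pullback _ dc) (derive_pullback _ de).
  rewrite (@derive_pullback _ _ (id : R^o -> R^o)) //.
  rewrite derive1_id eE; last exact: U2U.
  rewrite !mxE eqxx /GRing.scale /=.
  have [->|k0] := eqVneq k 0; first by rewrite /= !(mul0r, mulr0, add0r, mulr1).
  rewrite (ord2_neq0 k0).
  by rewrite /= !(mul1r, mul0r, mulr0, addr0).
have AI x : V x -> colsub s (A x) = 1%:M.
  move=> Vx; have wj := w0 _ Vx; have ei := e0 _ (UU2 _ Vx).
  apply/matrixP => k l; rewrite [LHS]mxE [LHS]mxE [RHS]mxE /= /s.
  have [k0|/ord2_neq0 k0] := eqVneq k 0; have [l0|/ord2_neq0 l0] := eqVneq l 0;
    rewrite ?k0 ?l0 ?eqxx /= ?wi0 ?mul0r ?mulr0 ?subr0 ?divff // ?mulr1 ?subrr //.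
(* As [A] is the identity in columns [i0, j0], the coefficients of the Jacobian on [A] are its
   entries in those columns. *)
have JBA x : V x -> 'J (chart g \o Tan g gamma) x =
    colsub s ('J (chart g \o Tan g gamma) x) *m A x.
  move=> Vx; have wj := w0 _ Vx; have ei := e0 _ (UU2 _ Vx).
  apply/matrixP => k j; rewrite [RHS]mxE sum_ord2.
  rewrite [colsub _ _ _ 0]mxE [colsub _ _ _ 1]mxE !JE // /s /=.
  rewrite [A x 0 j]mxE [A x 1 j]mxE /=.
  have [_|_] := eqVneq k 0; first exact: tangent_row0.
  have D j' : derive1 (e j') (x 0 1) =
      (x 0 1 ^+ b' * w j' (x 0 1) + e j' (x 0 1) * derive1 (e i0) (x 0 1)) /
      e i0 (x 0 1).
    apply/eqP; rewrite -(inj_eq (mulfI ei)) [eqbRHS]mulrC divfK //.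
    by rewrite -wE ?subrK //; exact: UU2.
  by rewrite (D j) (D j0); exact: tangent_row1.
exists V; split=> //.
apply: (@frontal_on_plane_field _ _ _ V g _ oV _ Fs s A) => //.
- by move=> x Vx; exact: chart_dom_affine_pt.
- apply/(smooth_on_mxP _ oV) => k j.
  have quot (f h : R^o -> R^o) : smooth_on U2 f ->
      smooth_on U2 (fun t => (h t)^-1 : R^o) ->
      smooth_on V (fun x : 'rV[R]_2 => f (x 0 1) / h (x 0 1) : R^o).
    by move=> fs hs; exact: (smooth_onM oV (pb _ fs) (pb _ hs)).
  have wq := quot _ _ (ws2 j) wVs.
  have [->|k0] := eqVneq k 0.
    apply: (eq_smooth_on oV _ (smooth_onB oV (quot _ _ (es2 j) eVs)
                             (smooth_onM oV (quot _ _ (es2 j0) eVs) wq))).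
    by move=> x _; rewrite mxE.
  by apply: (eq_smooth_on oV _ wq) => x _; rewrite mxE /= (negPf k0).
- by move=> x Vx; rewrite JBA // submxMl.
- move=> x Vx; apply: closure_subset (dense_neq0_coords oV Vx) => y [Vy yN].
  split=> //=; rewrite JBA // eqmxMfull; first exact: colsub_rank (AI y Vy).
  (* The coefficient matrix has determinant [s t^b' w_j0], nonzero when [s] and [t] are. *)
  rewrite row_full_unit unitmxE unitfE det_ord2.
  rewrite [colsub _ _ 0 0]mxE [colsub _ _ 1 1]mxE [colsub _ _ 0 1]mxE.
  rewrite [colsub _ _ 1 0]mxE !JE // /s /= tangent_det wE; last exact: UU2.
  by rewrite !mulf_neq0 ?expf_neq0 ?yN //; exact: w0.
Qed.


End FrontalGerms.


Theorem theorem2p4 (R : realType) (N : nat) (gamma : R -> RP R N.+1)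
    (hsmooth : smooth_germ (curve_map gamma))
    (hfinite : finite_type gamma 0%R) :
  frontal_germ (curve_map gamma) /\
  ((1 <= N)%N -> forall g : frame R N.+1,
     centred g (gamma 0%R) -> frontal_germ (Tan g gamma)).
Proof.
split.
  have [g [g0 _]] := hfinite.
  have [U [oU U0 gdom cs nflat]] := finite_type_chart hsmooth hfinite g0.
  exact: (curve_frontal oU U0 gdom cs g0.2 nflat ord0).
move=> N1 g g0.
have [U [oU U0 gdom cs nflat]] := finite_type_chart hsmooth hfinite g0.
(* For [N >= 1] the first and the last of the [N+1] coordinates are distinct. *)
apply: (@Tan_frontal _ _ _ _ _ oU U0 cs g0.2 nflat ord0 ord_max).
by rewrite -val_eqE /= -lt0n.
Qed.
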